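(* Let $K$ be a complete, algebraically closed nonarchimedean valued field, and let $\varphi(z)\in K(z)$ with $\deg(\varphi)\ge 2$. Suppose $P\in\mathbf P^1_K$ and $\vec v\in T_P$. If $\varphi(B_P(\vec v)^-)=\mathbf P^1_K$, then $B_P(\vec v)^-$ contains either a (classical) fixed point of $\varphi$ in $\mathbb P^1(K)$, or a repelling fixed point of $\varphi$ in $\mathbf H^1_K$.
   Context: $\mathbf P^1_K$ is the Berkovich projective line over $K$ (a uniquely path-connected Hausdorff space containing $\mathbb P^1(K)$), on which $\varphi$ acts, and $\mathbf H^1_K=\mathbf P^1_K\setminus\mathbb P^1(K)$. For $P\in\mathbf P^1_K$, $T_P$ is the set of tangent directions at $P$ (equivalence classes of paths $(P,x]$ sharing an initial segment; these correspond to the path-components of $\mathbf P^1_K\setminus\{P\}$), and $B_P(\vec v)^-$ is the path-component of $\mathbf P^1_K\setminus\{P\}$ in the direction $\vec v\in T_P$. A fixed point $P\in\mathbf H^1_K$ of $\varphi$ is repelling if the local degree $\deg_\varphi(P)$ is at least $2$. *)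

(* Defs.v *)
From HB Require Import structures.
From mathcomp Require Import all_boot all_order all_algebra.
From mathcomp Require Import all_classical all_reals all_analysis.
Import Order.TTheory GRing.Theory Num.Theory.
Import numFieldNormedType.Exports.

Set Implicit Arguments.
Unset Strict Implicit.
Unset Printing Implicit Defensive.

Local Open Scope classical_set_scope.
Local Open Scope ring_scope.

Record nonarchAbs (R : realType) (K : fieldType) := NonarchAbs {
  absv :> K -> R;
  absv_ge0 : forall a, 0 <= absv a;
  absv_eq0 : forall a, (absv a == 0) = (a == 0);
  absvM : forall a b, absv (a * b) = absv a * absv b;
  absvD : forall a b, absv (a + b) <= Num.max (absv a) (absv b) }.

Definition abs_complete (R : realType) (K : fieldType) (abs : nonarchAbs R K) :=
  forall u : nat -> K,
    (forall e : R, 0 < e -> exists N : nat, forall m n : nat,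
       (N <= m)%N -> (N <= n)%N -> abs (u m - u n) < e) ->
    exists l : K, forall e : R, 0 < e -> exists N : nat, forall n : nat,
       (N <= n)%N -> abs (u n - l) < e.

Lemma absv1 (R : realType) (K : fieldType) (abs : nonarchAbs R K) : abs 1 = 1.
Proof.
have n0 : abs 1 != 0 by rewrite absv_eq0 oner_eq0.
by apply: (mulfI n0); rewrite -absvM !mulr1.
Qed.

Lemma absvX (R : realType) (K : fieldType) (abs : nonarchAbs R K) a n :
  abs (a ^+ n) = abs a ^+ n.
Proof. by elim: n => [|n IHn]; rewrite ?expr0 ?absv1// !exprS absvM IHn. Qed.

(* Proj construction of the Berkovich projective line.  A point is an
   equivalence class of multiplicative seminorms [[.]] on K[X, Y] extending the
   absolute value of K and not vanishing at both X and Y; two of them are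
   equivalent when there is C > 0 with [[G]]_1 = C ^ d * [[G]]_2 for every d and
   every form G of degree d.  A class is recorded by the restriction to forms of
   its representative with max([[X]], [[Y]]) = 1.
   A form of degree d is given by d and p : {poly K} with size p <= d.+1, which
   stand for Y ^ d * p (X / Y); so X and Y are (1, 'X) and (1, 1).  Outside
   these pairs hnorm is set to 0, which makes equality of points the equality of
   the classes. *)
Record berkP1 (R : realType) (K : fieldType) (abs : nonarchAbs R K) := BerkP1 {
  hnorm :> nat -> {poly K} -> R;
  hnorm_ge0 : forall d p, 0 <= hnorm d p;
  hnorm_out : forall d (p : {poly K}), (d.+1 < size p)%N -> hnorm d p = 0;
  hnormC : forall c, hnorm 0 c%:P = abs c;
  hnormM : forall d e (p q : {poly K}), (size p <= d.+1)%N -> (size q <= e.+1)%N ->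
    hnorm (d + e) (p * q) = hnorm d p * hnorm e q;
  hnormD : forall d (p q : {poly K}), (size p <= d.+1)%N -> (size q <= d.+1)%N ->
    hnorm d (p + q) <= Num.max (hnorm d p) (hnorm d q);
  hnorm_normal : Num.max (hnorm 1 'X) (hnorm 1 1) = 1 }.

Section Topology.
Variables (R : realType) (K : fieldType) (abs : nonarchAbs R K).

HB.instance Definition _ := gen_eqMixin (berkP1 abs).
HB.instance Definition _ := gen_choiceMixin (berkP1 abs).

Definition berk_eval (x : berkP1 abs) : {ptws (nat * {poly K}) -> R} :=
  fun i => x i.1 i.2.

HB.instance Definition _ :=
  Topological.copy (berkP1 abs) (initial_topology berk_eval).

End Topology.

Section Classical.
Variables (R : realType) (K : fieldType) (abs : nonarchAbs R K).

Definition classical_fun (a : option K) (d : nat) (p : {poly K}) : R :=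
  if (size p <= d.+1)%N then
    if a is Some z then abs p.[z] / Num.max (abs z) 1 ^+ d else abs p`_d
  else 0.

Let max1_gt0 (z : K) : 0 < Num.max (abs z) 1.
Proof. by rewrite lt_max ltr01 orbT. Qed.

Let cf_ge0 a d p : 0 <= classical_fun a d p.
Proof.
rewrite /classical_fun; case: ifP => // _; case: a => [z|]; last exact: absv_ge0.
by rewrite divr_ge0 ?absv_ge0// exprn_ge0// ltW.
Qed.

Let cf_out a d (p : {poly K}) : (d.+1 < size p)%N -> classical_fun a d p = 0.
Proof. by rewrite /classical_fun ltnNge => /negbTE ->. Qed.

Let cfC a c : classical_fun a 0 c%:P = abs c.
Proof.
rewrite /classical_fun size_polyC leq_b1.
by case: a => [z|]; rewrite ?hornerC ?expr0 ?divr1// coefC.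
Qed.

Let size_mul_form d e (p q : {poly K}) :
  (size p <= d.+1)%N -> (size q <= e.+1)%N -> (size (p * q)%R <= (d + e).+1)%N.
Proof.
move=> hp hq; apply: leq_trans (size_polyMleq p q) _.
have h := leq_add hp hq; by move: h; rewrite addSn addnS; case: (_ + _)%N.
Qed.

Let coef_top d e (p q : {poly K}) :
  (size p <= d.+1)%N -> (size q <= e.+1)%N -> (p * q)`_(d + e) = p`_d * q`_e.
Proof.
move=> hp hq; rewrite coefM.
have hd : (d < (d + e).+1)%N by rewrite ltnS leq_addr.
rewrite (bigD1 (Ordinal hd))//= addKn big1 ?addr0// => -[i hi] /=.
rewrite -val_eqE/= neq_ltn => /orP[lt|gt].
- rewrite [q`__]nth_default ?mulr0//; apply: leq_trans hq _.
  by rewrite ltn_subRL ltn_add2r.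
- by rewrite [p`__]nth_default ?mul0r//; apply: leq_trans hp _.
Qed.

Let cfM a d e (p q : {poly K}) : (size p <= d.+1)%N -> (size q <= e.+1)%N ->
  classical_fun a (d + e) (p * q) = classical_fun a d p * classical_fun a e q.
Proof.
move=> hp hq; rewrite /classical_fun (size_mul_form hp hq) hp hq.
case: a => [z|]; last by rewrite (coef_top hp hq) absvM.
by rewrite hornerM absvM exprD invfM mulrACA.
Qed.

Let cfD a d (p q : {poly K}) : (size p <= d.+1)%N -> (size q <= d.+1)%N ->
  classical_fun a d (p + q) <= Num.max (classical_fun a d p) (classical_fun a d q).
Proof.
move=> hp hq; rewrite /classical_fun hp hq.
have -> : (size (p + q)%R <= d.+1)%N.
  by apply: leq_trans (size_polyD p q) _; rewrite geq_max hp hq.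
case: a => [z|]; last by rewrite coefD absvD.
rewrite -maxr_pMl ?invr_ge0 ?exprn_ge0 ?(ltW (max1_gt0 z))//.
by rewrite ler_pM2r ?invr_gt0 ?exprn_gt0 ?max1_gt0// hornerD absvD.
Qed.

Let cf_normal a :
  Num.max (classical_fun a 1 'X) (classical_fun a 1 1) = 1.
Proof.
rewrite /classical_fun size_polyX size_poly1 /=.
case: a => [z|]; last first.
  rewrite coefX/= coef1/= absv1.
  by have /eqP -> : abs 0 == 0; rewrite ?absv_eq0// max_l.
rewrite hornerX hornerC absv1 expr1 -maxr_pMl ?invr_ge0 ?(ltW (max1_gt0 z))//.
by rewrite divff// gt_eqF.
Qed.

(* P^1(K) is option K, None being the point at infinity; the seminorm of
   [a : b] is G |-> |G(a, b)| / max(|a|, |b|) ^ d on forms of degree d. *)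
Definition classical_pt (a : option K) : berkP1 abs :=
  BerkP1 (cf_ge0 a) (@cf_out a) (cfC a) (@cfM a) (@cfD a) (cf_normal a).

Definition hyperbolic : set (berkP1 abs) := ~` range classical_pt.

End Classical.

(* An element ratNum / ratDen of K(z) in lowest terms. *)
Record ratFun (K : fieldType) := RatFun {
  ratNum : {poly K};
  ratDen : {poly K};
  ratDen_neq0 : ratDen != 0;
  ratFun_coprime : coprimep ratNum ratDen }.

Definition ratFun_deg (K : fieldType) (phi : ratFun K) : nat :=
  (maxn (size (ratNum phi)) (size (ratDen phi))).-1.

(* If (d, p) stands for the form G and f, g for F_1, F_2 of degree e, this is
   G(F_1, F_2), a form of degree d * e. *)
Definition form_comp (K : fieldType) (f g : {poly K}) (d : nat) (p : {poly K}) :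
    {poly K} :=
  \sum_(i < d.+1) p`_i *: (f ^+ i * g ^+ (d - i)).

Section FormComp.
Variables (K : fieldType) (f g : {poly K}).

Lemma form_compD d p q :
  form_comp f g d (p + q) = form_comp f g d p + form_comp f g d q.
Proof.
by rewrite /form_comp -big_split; apply: eq_bigr => i _; rewrite coefD scalerDl.
Qed.

Lemma form_compZ d c p : form_comp f g d (c *: p) = c *: form_comp f g d p.
Proof.
by rewrite /form_comp scaler_sumr; apply: eq_bigr => i _; rewrite coefZ scalerA.
Qed.

Lemma form_comp_sum d (I : Type) (r : seq I) (F : I -> {poly K}) :
  form_comp f g d (\sum_(i <- r) F i) = \sum_(i <- r) form_comp f g d (F i).
Proof.
elim: r => [|i r IHr]; last by rewrite !big_cons form_compD IHr.
rewrite !big_nil /form_comp big1// => i _.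
by rewrite coef0 scale0r.
Qed.

Lemma form_compXn d n : (n <= d)%N ->
  form_comp f g d 'X^n = f ^+ n * g ^+ (d - n).
Proof.
move=> hn; have hn' : (n < d.+1)%N by [].
rewrite /form_comp (bigD1 (Ordinal hn'))//= coefXn eqxx scale1r big1 ?addr0//.
by move=> i /negPf ne; rewrite coefXn -[X in _ == X]/(val (Ordinal hn')) val_eqE ne scale0r.
Qed.

Lemma form_compM d e (p q : {poly K}) : (size p <= d.+1)%N -> (size q <= e.+1)%N ->
  form_comp f g (d + e) (p * q) = form_comp f g d p * form_comp f g e q.
Proof.
have expand m (r : {poly K}) : (size r <= m)%N -> r = \sum_(i < m) r`_i *: 'X^i.
  move=> h; rewrite -poly_def; apply/polyP => i; rewrite coef_poly.
  by case: ltnP => // hi; rewrite nth_default//; apply: leq_trans h hi.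
move=> hp hq; rewrite {1}(expand _ _ hp) {1}(expand _ _ hq).
rewrite mulr_suml form_comp_sum [in RHS]/form_comp mulr_suml.
apply: eq_bigr => i _; rewrite mulr_sumr form_comp_sum mulr_sumr.
apply: eq_bigr => j _.
have hi : (i <= d)%N by rewrite -ltnS.
have hj : (j <= e)%N by rewrite -ltnS.
rewrite -!scalerAl -!scalerAr -exprD !form_compZ form_compXn ?leq_add//.
rewrite mulrACA -!exprD; congr (_ *: (_ *: (_ * _ ^+ _))).
by rewrite subnDA -addnBAC// addnBA.
Qed.

Lemma size_form_comp d e p : (size f <= e.+1)%N -> (size g <= e.+1)%N ->
  (size (form_comp f g d p) <= (d * e).+1)%N.
Proof.
move=> hf hg; apply: (leq_trans (size_sum _ _ _)); apply/bigmax_leqP => i _.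
apply: leq_trans (size_scale_leq _ _) _.
apply: leq_trans (size_polyMleq _ _) _.
have hX (h : {poly K}) n : (size h <= e.+1)%N -> (size (h ^+ n)%R <= (n * e).+1)%N.
  move=> hh; apply: leq_trans (size_poly_exp_leq _ _) _.
  by rewrite ltnS mulnC leq_mul2l; case: (size h) hh => [|k] /=; rewrite ?leq0n ?orbT// ltnS => ->; rewrite orbT.
have := leq_add (hX f i hf) (hX g (d - i)%N hg).
have hi : (i <= d)%N by rewrite -ltnS.
rewrite addSn addnS -mulnDl subnKC// => h.
by case: (_ + _)%N h.
Qed.

End FormComp.

Section Action.
Variables (R : realType) (K : fieldType) (abs : nonarchAbs R K).
Variables (phi : ratFun K) (x : berkP1 abs).

Local Notation f := (ratNum phi).
Local Notation g := (ratDen phi).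
Local Notation e := (ratFun_deg phi).

Lemma size_num : (size f <= e.+1)%N.
Proof. by rewrite (leq_trans _ (leqSpred _))// leq_maxl. Qed.

Lemma size_den : (size g <= e.+1)%N.
Proof. by rewrite (leq_trans _ (leqSpred _))// leq_maxr. Qed.

Definition ratFun_max : R := Num.max (x e f) (x e g).

Lemma hnorm0 d : x d 0 = 0.
Proof.
have h0 : x 0%N 0 = 0.
  by rewrite -[0 in LHS]/(0%:P) hnormC; apply/eqP; rewrite absv_eq0.
by rewrite -[d]addn0 -(mulr0 1) hnormM ?size_poly0 ?size_poly1// h0 mulr0.
Qed.

Lemma hnormXn d : x d 'X^d = x 1%N 'X ^+ d.
Proof.
elim: d => [|d IHd]; first by rewrite expr0 -[1]/(1%:P) hnormC absv1.
by rewrite -add1n exprS hnormM ?size_polyX ?size_polyXn// IHd exprS.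
Qed.

Lemma hnormYn d : x d 1 = x 1%N 1 ^+ d.
Proof.
elim: d => [|d IHd]; first by rewrite expr0 -[1]/(1%:P) hnormC absv1.
by rewrite -add1n -{1}(mulr1 1) hnormM ?size_poly1// IHd exprS.
Qed.

(* The two forms defining phi have no common zero, even in the Berkovich sense. *)
Lemma ratFun_max_gt0 : 0 < ratFun_max.
Proof.
have hle : 0 <= ratFun_max by rewrite le_max hnorm_ge0.
rewrite lt_neqAle hle andbT eq_sym; apply/negP => /eqP h0.
have hf0 : x e f = 0.
  by apply/eqP; rewrite eq_le hnorm_ge0 andbT -h0 le_max lexx.
have hg0 : x e g = 0.
  by apply/eqP; rewrite eq_le hnorm_ge0 andbT -h0 le_max lexx orbT.
have hY : x 1%N 1 = 0.
  have /Bezout_eq1_coprimepP [[u v] /= huv] := ratFun_coprime phi.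
  pose m := maxn (size u) (size v).
  have hu : (size u <= m.+1)%N by rewrite leqW// leq_maxl.
  have hv : (size v <= m.+1)%N by rewrite leqW// leq_maxr.
  have su : (size (u * f)%R <= (m + e).+1)%N.
    rewrite (leq_trans (size_polyMleq _ _))//.
    by have := leq_add hu size_num; rewrite addSn addnS; case: (_ + _)%N.
  have sv : (size (v * g)%R <= (m + e).+1)%N.
    rewrite (leq_trans (size_polyMleq _ _))//.
    by have := leq_add hv size_den; rewrite addSn addnS; case: (_ + _)%N.
  have := hnormD x su sv.
  rewrite huv !hnormM ?size_num ?size_den// hf0 hg0 !mulr0 maxxx hnormYn => h.
  apply/eqP; have /eqP : x 1%N 1 ^+ (m + e) = 0.
    by apply/eqP; rewrite eq_le h exprn_ge0// hnorm_ge0.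
  by rewrite expf_eq0 => /andP[].
have hX : x 1%N 'X = 1.
  by have := hnorm_normal x; rewrite hY max_l// hnorm_ge0.
(* modulo Y a form of degree d is its X^d-monomial *)
have lead d (p : {poly K}) : (size p <= d.+1)%N -> abs p`_d <= x d p.
  move=> hp; case: d hp => [|d] hp.
    by rewrite {2}(size1_polyC hp) hnormC.
  pose q := take_poly d.+1 p.
  have sq : (size q <= d.+1)%N by apply: size_take_poly.
  have Eq : (p`_d.+1)%:P * 'X^(d.+1) = p - q.
    apply/polyP => i; rewrite coefCM coefXn coefB coef_take_poly.
    case: ltngtP => [lt|gt|->]; rewrite ?mulr0 ?mulr1 ?subrr ?subr0//.
    by rewrite nth_default// (leq_trans hp).
  have xq : x d.+1 q = 0.
    by rewrite -(mul1r q) -add1n hnormM ?size_poly1// hY mul0r.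
  have xNq : x d.+1 (- q) = 0.
    by rewrite -(mul1r (- q)) -add1n hnormM ?size_poly1 ?size_polyN// hY mul0r.
  have : x (0 + d.+1)%N ((p`_d.+1)%:P * 'X^(d.+1)) = abs p`_d.+1.
    by rewrite hnormM ?size_polyC ?leq_b1 ?size_polyXn// hnormC hnormXn hX expr1n mulr1.
  rewrite add0n Eq => <-; apply: le_trans (hnormD _ _ _) _ => //.
    by rewrite size_polyN leqW.
  by rewrite xNq ge_max lexx hnorm_ge0.
have lf := lead _ _ size_num; have lg := lead _ _ size_den.
rewrite hf0 in lf; rewrite hg0 in lg.
have zf : f`_e = 0.
  by apply/eqP; rewrite -(absv_eq0 abs) eq_le lf absv_ge0.
have zg : g`_e = 0.
  by apply/eqP; rewrite -(absv_eq0 abs) eq_le lg absv_ge0.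
have g0 := ratDen_neq0 phi.
have [hfg|hgf] := leqP (size f) (size g).
  move: zg; rewrite /ratFun_deg (maxn_idPr hfg) -/(lead_coef g) => /eqP.
  by rewrite lead_coef_eq0 (negPf g0).
move: zf; rewrite /ratFun_deg (maxn_idPl (ltnW hgf)) -/(lead_coef f) => /eqP.
by rewrite lead_coef_eq0 => /eqP f0; rewrite f0 size_poly0 in hgf.
Qed.

Definition ratFun_map_fun (d : nat) (p : {poly K}) : R :=
  if (size p <= d.+1)%N then x (d * e)%N (form_comp f g d p) / ratFun_max ^+ d
  else 0.

Let sz d p : (size (form_comp f g d p) <= (d * e).+1)%N.
Proof. exact: size_form_comp size_num size_den. Qed.

Let rm_ge0 d p : 0 <= ratFun_map_fun d p.
Proof.
rewrite /ratFun_map_fun; case: ifP => // _.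
by rewrite divr_ge0 ?hnorm_ge0// exprn_ge0// ltW// ratFun_max_gt0.
Qed.

Let rm_out d (p : {poly K}) : (d.+1 < size p)%N -> ratFun_map_fun d p = 0.
Proof. by rewrite /ratFun_map_fun ltnNge => /negbTE ->. Qed.

Let rmC c : ratFun_map_fun 0 c%:P = abs c.
Proof.
rewrite /ratFun_map_fun size_polyC leq_b1 /form_comp big_ord1 coefC/= !expr0.
by rewrite mulr1 alg_polyC hnormC divr1.
Qed.

Let rmM d d' (p q : {poly K}) : (size p <= d.+1)%N -> (size q <= d'.+1)%N ->
  ratFun_map_fun (d + d') (p * q) = ratFun_map_fun d p * ratFun_map_fun d' q.
Proof.
move=> hp hq; rewrite /ratFun_map_fun hp hq.
have -> : (size (p * q)%R <= (d + d').+1)%N.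
  rewrite (leq_trans (size_polyMleq _ _))//.
  by have := leq_add hp hq; rewrite addSn addnS; case: (_ + _)%N.
by rewrite form_compM// mulnDl hnormM// exprD invfM mulrACA.
Qed.

Let rmD d (p q : {poly K}) : (size p <= d.+1)%N -> (size q <= d.+1)%N ->
  ratFun_map_fun d (p + q) <= Num.max (ratFun_map_fun d p) (ratFun_map_fun d q).
Proof.
move=> hp hq; rewrite /ratFun_map_fun hp hq.
have -> : (size (p + q)%R <= d.+1)%N.
  by apply: leq_trans (size_polyD p q) _; rewrite geq_max hp hq.
have M0 : 0 < (ratFun_max ^+ d)^-1 by rewrite invr_gt0 exprn_gt0// ratFun_max_gt0.
by rewrite -maxr_pMl ?(ltW M0)// ler_pM2r// form_compD hnormD.
Qed.

Let rm_normal : Num.max (ratFun_map_fun 1 'X) (ratFun_map_fun 1 1) = 1.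
Proof.
rewrite /ratFun_map_fun size_polyX size_poly1/= mul1n expr1.
have -> : form_comp f g 1 'X = f.
  by rewrite (@form_compXn _ f g 1 1)// subnn expr0 expr1 mulr1.
have -> : form_comp f g 1 1 = g.
  by rewrite (@form_compXn _ f g 1 0)// subn0 expr0 expr1 mul1r.
rewrite -maxr_pMl ?invr_ge0 ?(ltW ratFun_max_gt0)//.
by rewrite divff// gt_eqF// ratFun_max_gt0.
Qed.

(* The action of phi = [F_1 : F_2]: [[G]]_(phi x) = [[G(F_1, F_2)]]_x, up to
   normalization. *)
Definition ratFun_map : berkP1 abs :=
  BerkP1 rm_ge0 rm_out rmC rmM rmD rm_normal.

End Action.

Section Directions.
Variables (R : realType) (T : topologicalType).

Definition path_component (A : set T) (x : T) : set T :=
  [set y | exists gamma : R -> T,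
    [/\ {within `[0 : R, 1], continuous gamma}, gamma 0 = x, gamma 1 = y &
        gamma @` `[0, 1] `<=` A]].

Definition arc_from (P : T) : set (R -> T) :=
  [set gamma : R -> T |
    [/\ {within `[0 : R, 1], continuous gamma},
        {in `[0 : R, 1] &, injective gamma} & gamma 0 = P]].

Definition same_germ (gamma delta : R -> T) : Prop :=
  exists s t : R, [/\ 0 < s <= 1, 0 < t <= 1 &
    gamma @` `[0, s] = delta @` `[0, t]].

(* The set T_P: a tangent direction is a full same_germ-class of arcs. *)
Definition tangent_dirs (P : T) : set (set (R -> T)) :=
  [set v | exists2 gamma, arc_from P gamma &
    v = [set delta | arc_from P delta /\ same_germ gamma delta]].

(* B_P(v)^-; the arcs of v lie in a single path-component away from P. *)
Definition dir_component (P : T) (v : set (R -> T)) : set T :=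
  \bigcup_(gamma in v) path_component (~` [set P]) (gamma 1).

End Directions.

Section LocalDegree.
Variables (R : realType) (K : fieldType) (abs : nonarchAbs R K).
Variable phi : ratFun K.

(* Multiplicity of a in P^1(K) as a solution of phi(a) = b: order of vanishing
   at a of the form b_1 F_1 - b_0 F_2 of degree deg(phi), where b = [b_0 : b_1];
   it is 0 if phi(a) != b. *)
Definition preim_mult (b a : option K) : nat :=
  let h := if b is Some c then ratNum phi - c *: ratDen phi else ratDen phi in
  if a is Some z then mup z h else (ratFun_deg phi).+1 - size h.

Definition preim_count (V : set (berkP1 abs)) (b : option K) : nat :=
  \big[addn/0%N]_(a \in [set a | V (classical_pt abs a)]) preim_mult b a.

(* Topological description of the local degree (abs being nontrivial).  If U is
   a small enough connected open neighbourhood of phi(P) and V the component of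
   phi^-1(U) containing P, then preim_count V b is 0 for b outside U, and it is
   one and the same number, namely deg_phi(P), for all b in U.  Hence deg_phi(P)
   is the minimum over the neighbourhoods V of P of the maximum over b in P^1(K)
   of preim_count V b: the largest k such that in every neighbourhood of P some
   b has at least k preimages counted with multiplicity. *)
Definition local_degree (P : berkP1 abs) : nat :=
  \max_(k < (ratFun_deg phi).+1 |
        `[< forall V : set (berkP1 abs), nbhs P V ->
              exists b : option K, (k <= preim_count V b)%N >]) k.

Definition repelling_fixed (P : berkP1 abs) : Prop :=
  [/\ hyperbolic P, ratFun_map phi P = P & (2 <= local_degree P)%N].

End LocalDegree.

(* Main.v *)
Require Import Defs.
From mathcomp Require Import all_boot all_order all_algebra.
From mathcomp Require Import all_classical all_reals all_analysis.
From mathcomp Require Import ring lra.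
Import Order.TTheory GRing.Theory Num.Theory.
Import numFieldNormedType.Exports.

(** Suppose that no classical point of [U = B_P(v)^-] is fixed by [phi = f / g]. The
    fixed points in [P^1(K)] are the zeros of a form of degree [deg phi + 1], so one of
    them exists, and it lies outside [U]. Moving it to infinity by the coordinate
    [1 / (z - b)], one may assume that infinity is not in [U]
    ([component_fixed_conj]).

    Write [zeta(a,s)] for the point of the closed disc of center [a] and radius [s],
    and [|.|_s] for its norm. As [phi(U)] is the whole line, [U] contains a pole [a] of
    [phi]. The path [s |-> zeta(a,s)] from [a] to infinity must leave [U], so
    [P = zeta(a,r)] with [0 < r <= oo] ([join_between]), and the classical points of [U]
    are those of the open disc of center [a] and radius [r]
    ([classical_in_component], [component_in_disc]).

    Let [N = f - z g]. It has no zeros in this disc, so [|N|_s = |N(a)|] for [s < r] and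
    the displacement [|phi(z) - z|] at [zeta(a,s)] is [|N(a)| / |g|_s]. It is infinite at
    [s = 0] and does not increase with [s]. It is smaller than [r] at [s = r], because
    [a = phi(x)] for some [x] in the disc, whose displacement is [|x - a| < r]. So some
    [0 < s < r] satisfies [s * |g|_s = |N(a)|] ([radius_exists]). Let [Q = zeta(a,s)].

    In [f - w g = (z - w) g + N], the norm at [Q] is that of the larger term: when both
    have norm [s * |g|_s], so does the value [f(a) = N(a)] of the sum
    ([anorm_num_sub_den]). Dividing by [|g|_s], [phi(Q)] and [Q] take the same values on
    all the [z - w], so [Q] is fixed ([disc_pt_fixed]). As [s] is in the value group,
    one can choose [c] in the closed disc of radius [s] away from finitely many residue
    classes; then the solutions of [phi = c] in this disc are in generic residue
    classes, hence close to [Q]. There are at least two of them, because just beyond the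
    radius [s] the norm of [f - c g] is that of [(z - c) g], which has the zeros [c] and
    [a] ([two_preimages], [near_two_preimages]). So [Q] is repelling. *)

Set Implicit Arguments.
Unset Strict Implicit.
Unset Printing Implicit Defensive.

Local Open Scope classical_set_scope.
Local Open Scope ring_scope.

(** * Seminorms attached to points *)

(** An ultrametric norm takes the larger value on a sum of two elements of different norms. *)
Lemma ultra_isosceles (R : realDomainType) (V : zmodType) (N : V -> R) (x y : V) :
  (forall x y, N (x + y) <= Num.max (N x) (N y)) -> (forall x, N (- x) = N x) ->
  N x < N y -> N (x + y) = N y.
Proof.
move=> ND NN lt; apply/eqP; rewrite eq_le; apply/andP; split.
  by apply: le_trans (ND _ _) _; rewrite ge_max lexx ltW.
have := ND (x + y) (- x); rewrite addrAC subrr add0r NN le_max => /orP[//|].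
by rewrite leNgt lt.
Qed.

Section AbsTheory.
Variables (R : realType) (K : fieldType) (abs : nonarchAbs R K).

Lemma absv0 : abs 0 = 0.
Proof. by apply/eqP; rewrite absv_eq0. Qed.

Lemma absvN a : abs (- a) = abs a.
Proof.
have h1 : abs (-1) = 1.
  have : abs (-1) ^+ 2 = 1 by rewrite -absvX sqrrN expr1n absv1.
  by move=> /eqP; rewrite sqrf_eq1 => /orP[/eqP//|/eqP h]; have := absv_ge0 abs (-1);
    rewrite h ler0N1.
by rewrite -mulN1r absvM h1 mul1r.
Qed.

Lemma absvB a b : abs (a - b) = abs (b - a).
Proof. by rewrite -opprB absvN. Qed.

Lemma absv_gt0 a : (0 < abs a) = (a != 0).
Proof. by rewrite lt_neqAle absv_ge0 andbT eq_sym absv_eq0. Qed.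

Lemma absv_isosceles a b : abs a < abs b -> abs (a + b) = abs b.
Proof. by apply: ultra_isosceles; [exact: absvD|exact: absvN]. Qed.

Lemma absv_prod (I : Type) (s : seq I) (F : I -> K) :
  abs (\prod_(i <- s) F i) = \prod_(i <- s) abs (F i).
Proof. by apply: (big_morph _ (absvM abs) (absv1 abs)). Qed.

Lemma absv_sum_le (I : Type) (s : seq I) (Q : pred I) (F : I -> K) (c : R) :
  0 <= c -> (forall i, Q i -> abs (F i) <= c) -> abs (\sum_(i <- s | Q i) F i) <= c.
Proof.
move=> c0 Fc; elim/big_ind: _ => //; first by rewrite absv0.
by move=> x y xc yc; apply: le_trans (absvD _ _ _) _; rewrite ge_max xc yc.
Qed.

Lemma absv_sum_lt (I : Type) (s : seq I) (Q : pred I) (F : I -> K) (c : R) :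
  0 < c -> (forall i, Q i -> abs (F i) < c) -> abs (\sum_(i <- s | Q i) F i) < c.
Proof.
move=> c0 Fc; elim/big_ind: _ => //; first by rewrite absv0.
by move=> x y xc yc; apply: le_lt_trans (absvD _ _ _) _; rewrite gt_max xc yc.
Qed.

End AbsTheory.

Lemma berkP1_eq (R : realType) (K : fieldType) (abs : nonarchAbs R K)
    (x y : berkP1 abs) : (forall d (p : {poly K}), (size p <= d.+1)%N -> x d p = y d p) -> x = y.
Proof.
move=> h; have {}h : hnorm x = hnorm y.
  apply/funext => d; apply/funext => p.
  by have [/h//|lt] := leqP (size p) d.+1; rewrite !hnorm_out.
case: x y h => [x x1 x2 x3 x4 x5 x6] [y y1 y2 y3 y4 y5 y6] /= xy.
subst y.
by rewrite (Prop_irrelevance x1 y1) (Prop_irrelevance x2 y2) (Prop_irrelevance x3 y3)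
  (Prop_irrelevance x4 y4) (Prop_irrelevance x5 y5) (Prop_irrelevance x6 y6).
Qed.

Section Anorm.
Variables (R : realType) (K : closedFieldType) (abs : nonarchAbs R K).
Implicit Types (x y : berkP1 abs) (p q : {poly K}).

Lemma hnormS x d k p : (size p <= d.+1)%N -> x (d + k)%N p = x d p * x 1%N 1 ^+ k.
Proof. by move=> hp; rewrite -{1}(mulr1 p) hnormM ?size_poly1// (hnormYn x k). Qed.

(** The seminorm on [K[z]] attached to a point [x] other than infinity: dehomogenize
    with [Y = 1] and divide by the value of [Y]. A form of any degree [d >= deg p]
    gives the same value, see [anormE]; the default degree is [deg p]. *)
Definition anorm x p : R := x (size p).-1 p / x 1%N 1 ^+ (size p).-1.

Variable x : berkP1 abs.
Hypothesis x1 : 0 < x 1%N 1.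

Lemma hnormE d p : (size p <= d.+1)%N -> x d p = anorm x p * x 1%N 1 ^+ d.
Proof.
move=> hp; have hd : ((size p).-1 <= d)%N by case: (size p) hp.
rewrite -{1}(subnKC hd) hnormS ?leqSpred// /anorm.
by rewrite -[in RHS](subnKC hd) exprD mulrA divfK// expf_neq0// gt_eqF.
Qed.

Lemma anormE d p : (size p <= d.+1)%N -> anorm x p = x d p / x 1%N 1 ^+ d.
Proof. by move=> /hnormE ->; rewrite mulfK// expf_neq0// gt_eqF. Qed.

Lemma anormC c : anorm x c%:P = abs c.
Proof. by rewrite (@anormE 0) ?size_polyC ?leq_b1// hnormC divr1. Qed.

Lemma anormM p q : anorm x (p * q) = anorm x p * anorm x q.
Proof.
set d := size p; set e := size q.
have hp : (size p <= d.+1)%N by exact: leqnSn.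
have hq : (size q <= e.+1)%N by exact: leqnSn.
have hpq : (size (p * q)%R <= (d + e).+1)%N.
  by rewrite (leq_trans (size_polyMleq _ _))// (leq_trans (leq_pred _)).
by rewrite (anormE hpq) hnormM// (anormE hp) (anormE hq) exprD invfM mulrACA.
Qed.

Lemma anormD p q : anorm x (p + q) <= Num.max (anorm x p) (anorm x q).
Proof.
set d := maxn (size p) (size q).
have hp : (size p <= d.+1)%N by rewrite leqW// leq_maxl.
have hq : (size q <= d.+1)%N by rewrite leqW// leq_maxr.
have hpq : (size (p + q)%R <= d.+1)%N.
  by rewrite (leq_trans (size_polyD _ _))// leqW.
rewrite (anormE hpq) (anormE hp) (anormE hq).
have M0 : 0 < (x 1%N 1 ^+ d)^-1 by rewrite invr_gt0 exprn_gt0.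
by rewrite -maxr_pMl ?(ltW M0)// ler_pM2r// Defs.hnormD.
Qed.

Lemma anormN p : anorm x (- p) = anorm x p.
Proof.
by rewrite -mulN1r -polyCN anormM -[(-1)%:P]/((-1)%:P) anormC absvN absv1 mul1r.
Qed.

Lemma anormZ c p : anorm x (c *: p) = abs c * anorm x p.
Proof. by rewrite -mul_polyC anormM anormC. Qed.

Lemma anorm_prod (I : Type) (s : seq I) (F : I -> {poly K}) :
  anorm x (\prod_(i <- s) F i) = \prod_(i <- s) anorm x (F i).
Proof.
apply: (big_morph _ anormM); by rewrite -[1]/(1%:P) anormC absv1.
Qed.

Lemma anorm_isosceles p q : anorm x p < anorm x q -> anorm x (p + q) = anorm x q.
Proof. by apply: ultra_isosceles; [exact: anormD|exact: anormN]. Qed.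

Lemma anorm_X_max : Num.max (anorm x 'X) 1 * x 1%N 1 = 1.
Proof.
rewrite maxr_pMl ?ltW// mul1r -[RHS](hnorm_normal x) (@hnormE 1 'X) ?size_polyX// expr1.
Qed.

End Anorm.

Section Separation.
Variables (R : realType) (K : closedFieldType) (abs : nonarchAbs R K).
Implicit Types (x y : berkP1 abs) (p q : {poly K}).

Lemma poly_split p : exists rs : seq K, p = lead_coef p *: \prod_(z <- rs) ('X - z%:P).
Proof. by have [r Er] := closed_field_poly_normal p; exists r. Qed.

(** Over an algebraically closed field a finite point is determined by its values on
    the polynomials [z - w]. *)
Lemma berk_eq_affine x y : 0 < x 1%N 1 -> 0 < y 1%N 1 ->
  (forall w, anorm x ('X - w%:P) = anorm y ('X - w%:P)) -> x = y.
Proof.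
move=> x1 y1 h.
have hp p : anorm x p = anorm y p.
  have [rs ->] := poly_split p.
  rewrite !anormZ// !anorm_prod//; congr (_ * _).
  by apply: eq_bigr => i _.
have h1 : x 1%N 1 = y 1%N 1.
  have := etrans (anorm_X_max x1) (esym (anorm_X_max y1)).
  rewrite hp => /mulfI; apply.
  by rewrite gt_eqF// lt_max ltr01 orbT.
by apply: berkP1_eq => d p sp; rewrite (hnormE x1 sp) (hnormE y1 sp) hp h1.
Qed.

Lemma hnorm_Y_eq0_or_gt0 x : x 1%N 1 = 0 \/ 0 < x 1%N 1.
Proof.
by have := hnorm_ge0 x 1 1; rewrite le_eqVlt eq_sym => /orP[/eqP|]; [left|right].
Qed.

(** The only point killing [Y] is infinity: there a form is reduced to its
    [X ^ d]-monomial. *)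
Lemma hnorm_inf x d p : x 1%N 1 = 0 -> (size p <= d.+1)%N -> x d p = abs p`_d.
Proof.
move=> x1 hp; have xX : x 1%N 'X = 1.
  by have := hnorm_normal x; rewrite x1 max_l// hnorm_ge0.
case: d hp => [|d] hp; first by rewrite {1}(size1_polyC hp) hnormC.
pose q := take_poly d.+1 p.
have sq : (size q <= d.+1)%N by apply: size_take_poly.
have Ep : p = (p`_d.+1)%:P * 'X^(d.+1) + q.
  apply/polyP => i; rewrite coefD coefCM coefXn coef_take_poly.
  case: ltngtP => [lt|gt|->]; rewrite ?mulr0 ?mulr1 ?add0r ?addr0//.
  by rewrite nth_default// (leq_trans hp).
have xq (r : {poly K}) : (size r <= d.+1)%N -> x d.+1 r = 0.
  by move=> sr; rewrite -(mul1r r) -add1n hnormM ?size_poly1// x1 mul0r.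
have Em : x d.+1 ((p`_d.+1)%:P * 'X^(d.+1)) = abs p`_d.+1.
  by rewrite -[d.+1]add0n hnormM ?size_polyC ?leq_b1 ?size_polyXn// hnormC hnormXn xX expr1n mulr1.
have sm : (size ((p`_d.+1)%:P * 'X^(d.+1))%R <= d.+2)%N.
  by rewrite mul_polyC (leq_trans (size_scale_leq _ _))// size_polyXn.
apply/eqP; rewrite eq_le; apply/andP; split.
  rewrite {1}Ep (le_trans (Defs.hnormD _ _ _))//; first exact: leqW.
  by rewrite Em xq// ge_max lexx absv_ge0.
rewrite -Em; have -> : (p`_d.+1)%:P * 'X^(d.+1) = p + - q by rewrite {2}Ep addrK.
have sNq : (size (- q) <= d.+1)%N by rewrite size_polyN.
apply: le_trans (Defs.hnormD x hp (leqW sNq)) _.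
by rewrite (xq _ sNq) ge_max lexx hnorm_ge0.
Qed.

Lemma classical_infP x : x 1%N 1 = 0 -> x = classical_pt abs None.
Proof.
move=> x1; apply: berkP1_eq => d p hp.
by rewrite (hnorm_inf x1 hp) /= /classical_fun hp.
Qed.

Lemma classical_inf1 : classical_pt abs None 1%N 1 = 0.
Proof. by rewrite /= /classical_fun size_poly1/= coef1/= absv0. Qed.

Lemma classical_fin1 z : 0 < classical_pt abs (Some z) 1%N 1.
Proof.
rewrite /= /classical_fun size_poly1/= hornerC absv1 divr_gt0// exprn_gt0//.
by rewrite lt_max ltr01 orbT.
Qed.

Lemma classical_root_eq0 w d p : p.[w] = 0 ->
  classical_pt abs (Some w) d p = 0.
Proof. by move=> pw; rewrite /= /classical_fun pw absv0 mul0r; case: ifP. Qed.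

Lemma anorm_classical z p : anorm (classical_pt abs (Some z)) p = abs p.[z].
Proof.
rewrite /anorm /= /classical_fun leqSpred size_poly1 /= hornerC absv1.
rewrite expr1 mul1r exprVn invrK divfK// expf_neq0//.
by rewrite gt_eqF// lt_max ltr01 orbT.
Qed.

Lemma hnorm_eq0_affine x p d : (size p <= d.+1)%N -> 0 < x 1%N 1 ->
  (x d p == 0) = (anorm x p == 0).
Proof. by move=> sp x1; rewrite hnormE// mulf_eq0 expf_eq0 (gt_eqF x1) andbF orbF. Qed.

(** A point is classical as soon as it kills a linear form, hence, by
    [classicalP], any nonzero form. *)
Lemma classical_finP x z : x 1%N ('X - z%:P) = 0 -> x = classical_pt abs (Some z).
Proof.
move=> xz; have x1 : 0 < x 1%N 1.
  have [x1|//] := hnorm_Y_eq0_or_gt0 x.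
  move: xz; rewrite (hnorm_inf x1) ?size_XsubC// coefB coefX coefC/= subr0 absv1.
  by move=> /eqP; rewrite oner_eq0.
have az : anorm x ('X - z%:P) = 0.
  by apply/eqP; rewrite -(@hnorm_eq0_affine _ _ 1) ?size_XsubC// xz.
apply: berk_eq_affine => //; first exact: classical_fin1.
move=> w; rewrite anorm_classical !hornerE.
have [<-|zw] := eqVneq z w; first by rewrite subrr absv0.
have -> : 'X - w%:P = ('X - z%:P) + (z - w)%:P by rewrite polyCB addrA subrK.
rewrite anorm_isosceles//; first exact: (anormC x1).
by rewrite az (anormC x1) absv_gt0 subr_eq0.
Qed.

Lemma classicalP x d p : p != 0 -> (size p <= d.+1)%N -> x d p = 0 ->
  exists a, x = classical_pt abs a /\ (if a is Some z then p.[z] = 0 else p`_d = 0).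
Proof.
move=> p0 sp xp; have [x1|x1] := hnorm_Y_eq0_or_gt0 x.
  exists None; split; first exact: classical_infP.
  by move: xp; rewrite (hnorm_inf x1 sp) => /eqP; rewrite absv_eq0 => /eqP.
move/eqP: xp; rewrite hnorm_eq0_affine//.
have [rs Ep] := poly_split p.
rewrite {1}Ep anormZ// anorm_prod// mulf_eq0 absv_eq0 lead_coef_eq0 (negPf p0)/=.
rewrite prodf_seq_eq0 => /hasP[z zrs /=].
rewrite -(@hnorm_eq0_affine _ _ 1) ?size_XsubC// => /eqP /classical_finP xz.
exists (Some z); split=> //.
by rewrite Ep hornerZ; apply/eqP; rewrite mulf_eq0 -[_.[z] == 0]/(root _ z) root_prod_XsubC zrs orbT.
Qed.

End Separation.

(** * Topology of the line and path-components *)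

Section BerkTopology.
Variables (R : realType) (K : fieldType) (abs : nonarchAbs R K).

Lemma hnorm_continuous d (p : {poly K}) : continuous (fun x : berkP1 abs => x d p : R).
Proof.
move=> x.
have h1 : continuous (@berk_eval R K abs).
  exact: initial_continuous.
apply: (@continuous_comp _ _ _ (@berk_eval R K abs) (fun g => g (d, p))); first exact: h1.
exact: (@proj_continuous _ (fun=> R)).
Qed.

(** Convergence is pointwise convergence of the values on forms. *)
Lemma berk_cvg (F : set_system (berkP1 abs)) (FF : Filter F) (Q : berkP1 abs) :
  (forall d p, (fun y : berkP1 abs => y d p) @ F --> Q d p) -> F --> Q.
Proof.
move=> h A [/= _ [[B Bop <-] /= BQ BA]].
have /(_ B) : (@berk_eval R K abs @ F) --> berk_eval Q.
  apply/cvg_sup => -[d p] C [/= _ [[D Dop <-] /= DQ DC]].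
  have : nbhs (Q d p : R) (D : set R) by apply: (@open_nbhs_nbhs R); split.
  by move=> /(h d p) FD; apply: (@filterS _ F _ _ _ _ FD) => y Dy; exact: DC.
have nB : nbhs (berk_eval Q) B by apply: open_nbhs_nbhs.
by move=> /(_ nB) FB; apply: (@filterS _ F _ _ _ _ FB) => y By; exact: BA.
Qed.

Lemma berk_continuousP (S : topologicalType) (f : S -> berkP1 abs) :
  (forall d p, continuous (fun s => f s d p : R)) -> continuous f.
Proof. by move=> h s; apply: berk_cvg => d p; exact: h. Qed.

(** Points agreeing with [Q] on a suitable finite set of forms lie in a given
    neighbourhood of [Q]. *)
Lemma nbhs_hnorm_eq (Q : berkP1 abs) (V : set (berkP1 abs)) : nbhs Q V ->
  exists L : seq (nat * {poly K}), forall y : berkP1 abs,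
    (forall i, i \in L -> y i.1 i.2 = Q i.1 i.2) -> V y.
Proof.
(* the filter of sets containing all the points that agree with Q on some finite
   set of forms converges to Q *)
pose F : set_system (berkP1 abs) := [set A | exists L : seq (nat * {poly K}),
  forall y : berkP1 abs, (forall i, i \in L -> y i.1 i.2 = Q i.1 i.2) -> A y].
have FF : Filter F.
  split.
  - by exists [::].
  - move=> A B [L1 h1] [L2 h2]; exists (L1 ++ L2) => y h; split.
      by apply: h1 => i iL; apply: h; rewrite mem_cat iL.
    by apply: h2 => i iL; apply: h; rewrite mem_cat iL orbT.
  - by move=> A B AB [L h]; exists L => y /h /AB.
move=> nV; suff h : F --> Q by exact: (h V nV).
apply: berk_cvg => d p A nA.
exists [:: (d, p)] => y /(_ (d, p)); rewrite mem_head /= => ->//.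
exact: nbhs_singleton.
Qed.

End BerkTopology.

Section PathComponents.
Variables (R : realType) (T : topologicalType).
Implicit Types (A : set T) (x y z : T).

Lemma path_componentW A x y : path_component R A x y -> A x /\ A y.
Proof.
move=> [g [_ <- <- h]]; split; apply: h.
  by exists 0 => //=; rewrite in_itv/= lexx ler01.
by exists 1 => //=; rewrite in_itv/= lexx ler01.
Qed.

Lemma within_comp_continuous (B : set R) (g : R -> T) (f : R -> R) :
  {within `[0, 1], continuous g} -> continuous f -> (forall t, B t -> f t \in `[0 : R, 1]) ->
  {within B, continuous (g \o f)}.
Proof.
move=> gc fc fB; apply/continuous_closedP => W cW.
move/continuous_closedP/(_ _ cW)/closed_subspaceP: gc => [V cV VE].
apply/closed_subspaceP; exists (f @^-1` V).
  by apply: closed_comp => // t _; exact: fc.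
apply/seteqP; split=> t [h Bt]; split=> //.
  have : (V `&` `[0 : R, 1]%classic) (f t) by split=> //; exact: fB.
  by rewrite VE => -[].
have : (g @^-1` W `&` `[0 : R, 1]%classic) (f t) by split=> //; exact: fB.
by rewrite -VE => -[].
Qed.

Lemma path_component_sym A x y : path_component R A x y -> path_component R A y x.
Proof.
move=> [g [gc g0 g1 gA]]; exists (g \o (fun t => 1 - t)); split.
- apply: within_comp_continuous => //.
    by move=> t; apply: cvgB; [exact: cvg_cst|exact: cvg_id].
  by move=> t /=; rewrite !in_itv/= => /andP[? ?]; lra.
- by rewrite /= subr0.
- by rewrite /= subrr.
- move=> _ [t /= t01 <-]; apply: gA; exists (1 - t) => //=.
  by move: t01; rewrite !in_itv/= => /andP[? ?]; lra.
Qed.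

Lemma path_component_trans A x y z :
  path_component R A x y -> path_component R A y z -> path_component R A x z.
Proof.
move=> [g [gc g0 g1 gA]] [h [hc h0 h1 hA]].
pose k (t : R) := if t <= 2^-1 then g (2 * t) else h (2 * t - 1).
have kl t : t <= 2^-1 -> k t = g (2 * t) by rewrite /k => ->.
have kr t : 2^-1 <= t -> k t = h (2 * t - 1).
  rewrite le_eqVlt => /orP[/eqP <-|lt]; last by rewrite /k leNgt lt.
  by rewrite kl// divff// subrr g1 h0.
have cl : {within `[0, 2^-1], continuous k}.
  apply: (@subspace_eq_continuous _ _ _ (g \o (fun t => 2 * t))).
    by move=> t; rewrite inE /= in_itv/= => /andP[_ ?]; rewrite /= -kl.
  apply: within_comp_continuous => //.
    by move=> t; apply: cvgM; [exact: cvg_cst|exact: cvg_id].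
  by move=> t /=; rewrite !in_itv/= => /andP[? ?]; lra.
have cr : {within `[2^-1, 1], continuous k}.
  apply: (@subspace_eq_continuous _ _ _ (h \o (fun t => 2 * t - 1))).
    by move=> t; rewrite inE /= in_itv/= => /andP[? _]; rewrite /= -kr.
  apply: within_comp_continuous => //.
    move=> t; apply: cvgB; last exact: cvg_cst.
    by apply: cvgM; [exact: cvg_cst|exact: cvg_id].
  by move=> t /=; rewrite !in_itv/= => /andP[? ?]; lra.
exists k; split.
- have -> : `[0 : R, 1]%classic = `[0 : R, 2^-1]%classic `|` `[2^-1 : R, 1]%classic.
    apply/seteqP; split=> t /=; rewrite !in_itv/=.
      by move=> /andP[-> ->]; rewrite andbT; apply/orP; exact: le_total.
    by case=> /andP[? ?]; lra.
  by apply: withinU_continuous => //; exact: interval_closed.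
- by rewrite kl ?mulr0//; lra.
- by rewrite kr; [rewrite (_ : 2 * 1 - 1 = 1)//; lra|lra].
- move=> w [t /=]; rewrite in_itv/= => /andP[t0 t1] <-.
  have [le|/ltW ge] := leP t 2^-1.
    by rewrite kl//; apply: gA; exists (2 * t) => //=; rewrite in_itv/=; lra.
  by rewrite kr//; apply: hA; exists (2 * t - 1) => //=; rewrite in_itv/=; lra.
Qed.

Lemma path_component_connected A x y : path_component R A x y ->
  exists C, [/\ connected C, C x, C y & C `<=` A].
Proof.
move=> [g [gc g0 g1 gA]]; exists (g @` `[0, 1]); split=> //.
- by apply: connected_continuous_connected => //; exact: segment_connected.
- by exists 0 => //=; rewrite in_itv/= lexx ler01.
- by exists 1 => //=; rewrite in_itv/= lexx ler01.
Qed.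

(** The union defining [B_P(v)^-] is a single path-component: two arcs with the same
    germ share points other than [P]. *)
Lemma dir_componentE (P : T) (v : set (R -> T)) : tangent_dirs P v ->
  exists2 x0, x0 <> P & dir_component P v = path_component R (~` [set P]) x0.
Proof.
move=> [g gP ->]; have arc1 (d : R -> T) : arc_from P d -> d 1 <> P.
  move=> [_ dinj d0]; rewrite -d0 => /dinj; rewrite !in_itv/= !lexx !ler01.
  by move=> /(_ isT isT) /eqP; rewrite oner_eq0.
have sub (d : R -> T) t : arc_from P d -> 0 < t <= 1 ->
    path_component R (~` [set P]) (d t) (d 1).
  move=> [dc dinj d0] /andP[t0 t1].
  exists (d \o (fun u => t + u * (1 - t))); split.
  - apply: within_comp_continuous => //.
      move=> u; apply: cvgD; first exact: cvg_cst.
      by apply: cvgM; [exact: cvg_id|exact: cvg_cst].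
    by move=> u /=; rewrite !in_itv/= => /andP[? ?]; nra.
  - by rewrite /= mul0r addr0.
  - by rewrite /= mul1r addrC subrK.
  - move=> w [u /=]; rewrite in_itv/= => /andP[u0 u1] <- /= E.
    have : t + u * (1 - t) = 0.
      by apply: dinj; rewrite ?in_itv/= ?E ?d0//; nra.
    by nra.
exists (g 1); first exact: arc1.
apply/seteqP; split=> y.
  move=> [d [dP [s [t [/andP[s0 s1] /andP[t0 t1] E]]]]].
  have : (g @` `[0, s]) (g s) by exists s => //=; rewrite in_itv/= lexx ltW.
  rewrite E => -[t' /=]; rewrite in_itv/= => /andP[t'0 t't] Eg.
  have t'P : 0 < t'.
    rewrite lt_neqAle t'0 andbT; apply/eqP => t'0'.
    case: (gP) (dP) => [_ ginj g0] [_ _ d0].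
    move: Eg; rewrite -t'0' d0 -g0 => /ginj; rewrite !in_itv/= lexx ler01 (ltW s0) s1.
    by move=> /(_ isT isT) s0'; rewrite -s0' ltxx in s0.
  apply: path_component_trans.
  apply: path_component_trans (path_component_sym (sub g s gP _)) _; first by rewrite s0.
  rewrite -Eg; apply: sub => //; rewrite t'P; lra.
move=> h; exists g => //; split=> //; exists 1, 1; split=> //; lra.
Qed.

End PathComponents.

Lemma path_component_homo (R : realType) (T : topologicalType) (h : T -> T) (P x y : T) :
  continuous h -> (forall z, h z = h P -> z = P) ->
  path_component R (~` [set P]) x y -> path_component R (~` [set h P]) (h x) (h y).
Proof.
move=> hc hinj [gam [gc g0 g1 gA]]; exists (h \o gam); split=> /=.
- by move=> t; exact: (@continuous_comp (subspace `[0 : R, 1]) T T gam h t (gc t) (hc (gam t))).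
- by rewrite g0.
- by rewrite g1.
- by move=> z [t t01 <-] /= /hinj E; apply: (gA (gam t)) => //; exists t.
Qed.

(** * Gauss norms *)

Section GaussNorm.
Variables (R : realType) (K : fieldType) (abs : nonarchAbs R K).
Variables (al be : R).
Hypotheses (al0 : 0 <= al) (be0 : 0 <= be).
Implicit Types p q : {poly K}.

(** The weighted Gauss norm of the form [sum_i p_i X^i Y^(d-i)], where [X] and [Y]
    get norms [al] and [be]; [be = 0] is allowed and corresponds to infinity. *)
Definition gauss_norm d p : R :=
  \big[Num.max/0]_(i < d.+1) (abs p`_i * (al ^+ i * be ^+ (d - i))).

Let w0 d i : 0 <= al ^+ i * be ^+ (d - i).
Proof. by rewrite mulr_ge0// exprn_ge0. Qed.

Let t0 d p i : 0 <= abs p`_i * (al ^+ i * be ^+ (d - i)).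
Proof. by rewrite mulr_ge0// absv_ge0. Qed.

Lemma gauss_norm_ge0 d p : 0 <= gauss_norm d p.
Proof. exact: bigmax_ge_id. Qed.

Lemma coef_le_gauss_norm d p i : (size p <= d.+1)%N ->
  abs p`_i * (al ^+ i * be ^+ (d - i)) <= gauss_norm d p.
Proof.
move=> sp; have [id|di] := ltnP i d.+1.
  exact: (le_bigmax 0 (fun i : 'I_d.+1 => abs p`_i * (al ^+ i * be ^+ (d - i))) (Ordinal id)).
by rewrite nth_default ?(leq_trans sp)// absv0 mul0r gauss_norm_ge0.
Qed.

Lemma gauss_norm_leP d p c : 0 <= c ->
  (forall i, (i <= d)%N -> abs p`_i * (al ^+ i * be ^+ (d - i)) <= c) ->
  gauss_norm d p <= c.
Proof. by move=> c0 h; apply: bigmax_le => // i _; apply: h; rewrite -ltnS. Qed.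

Lemma gauss_normC c : gauss_norm 0 c%:P = abs c.
Proof.
by rewrite /gauss_norm big_ord_recl big_ord0 coefC/= !expr0 !mulr1 max_l// absv_ge0.
Qed.

Lemma gauss_normD d p q : (size p <= d.+1)%N -> (size q <= d.+1)%N ->
  gauss_norm d (p + q) <= Num.max (gauss_norm d p) (gauss_norm d q).
Proof.
move=> sp sq; apply: gauss_norm_leP => [|i _]; first by rewrite le_max gauss_norm_ge0.
rewrite coefD; have := absvD abs p`_i q`_i; rewrite le_max => /orP[h|h];
  apply: le_trans (ler_wpM2r (w0 d i) h) _; rewrite le_max coef_le_gauss_norm// orbT//.
Qed.

(** The least index at which the maximum is reached. *)
Lemma gauss_norm_least d p : 0 < gauss_norm d p ->
  exists2 i, (i <= d)%N /\ abs p`_i * (al ^+ i * be ^+ (d - i)) = gauss_norm d p &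
    forall j, (j < i)%N -> abs p`_j * (al ^+ j * be ^+ (d - j)) < gauss_norm d p.
Proof.
move=> pos; set P := fun i => (i <= d)%N && (gauss_norm d p <= abs p`_i * (al ^+ i * be ^+ (d - i))).
have exP : exists i, P i.
  have [|i _ E] := @eq_bigmax _ _ _ (0 : R) ord0 xpredT (fun i : 'I_d.+1 => abs p`_i * (al ^+ i * be ^+ (d - i))) isT.
    by move=> i _; exact: t0.
  by exists i; rewrite /P -ltnS ltn_ord/= /gauss_norm E.
case: (ex_minnP exP) => i /andP[id ge] imin; exists i.
  split=> //; apply/eqP; rewrite eq_le ge andbT.
  exact: (le_bigmax 0 (fun i : 'I_d.+1 => abs p`_i * (al ^+ i * be ^+ (d - i))) (Ordinal (id : (i < d.+1)%N))).
move=> j ji; rewrite ltNge; apply/negP => h.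
have : P j by rewrite /P h andbT (leq_trans (ltnW ji)).
by move/imin; rewrite leqNgt ji.
Qed.

(** Gauss' lemma: with [i] and [j] the least indices reaching the norms of [p] and
    [q], the term [p_i q_j] strictly dominates the coefficient of index [i + j] of
    the product. *)
Lemma gauss_normM d e p q : (size p <= d.+1)%N -> (size q <= e.+1)%N ->
  gauss_norm (d + e) (p * q) = gauss_norm d p * gauss_norm e q.
Proof.
move=> sp sq; have A0 := gauss_norm_ge0 d p; have B0 := gauss_norm_ge0 e q.
have wM i j : (i <= d)%N -> (j <= e)%N ->
    al ^+ (i + j) * be ^+ (d + e - (i + j)) =
    (al ^+ i * be ^+ (d - i)) * (al ^+ j * be ^+ (e - j)).
  move=> id je; rewrite mulrACA -!exprD; congr (_ * be ^+ _).
  by rewrite subnDA -addnBAC// addnBA.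
have tM i j : (i <= d)%N -> (j <= e)%N ->
    abs (p`_i * q`_j) * (al ^+ (i + j) * be ^+ (d + e - (i + j))) =
    (abs p`_i * (al ^+ i * be ^+ (d - i))) * (abs q`_j * (al ^+ j * be ^+ (e - j))).
  by move=> id je; rewrite wM// absvM mulrACA.
have out i j : ((i <= d) && (j <= e))%N = false -> p`_i * q`_j = 0.
  move/negbT; rewrite negb_and -!ltnNge => /orP[h|h].
    by rewrite [p`_i]nth_default ?mul0r// (leq_trans sp).
  by rewrite [q`_j]nth_default ?mulr0// (leq_trans sq).
apply/eqP; rewrite eq_le; apply/andP; split.
  apply: gauss_norm_leP => [|k kde]; first exact: mulr_ge0.
  rewrite coefM; have [w|w] := eqVneq (al ^+ k * be ^+ (d + e - k)) 0.
    by rewrite w mulr0 mulr_ge0.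
  have wpos : 0 < al ^+ k * be ^+ (d + e - k).
    by rewrite lt_neqAle eq_sym w; exact: w0.
  rewrite -ler_pdivlMr//; apply: absv_sum_le => [|j _].
    by apply: divr_ge0; [exact: mulr_ge0|exact: w0].
  rewrite ler_pdivlMr//; have jk : (j <= k)%N by rewrite -ltnS.
  case E : ((j <= d) && (k - j <= e))%N; last by rewrite out// absv0 mul0r mulr_ge0.
  case/andP: E => jd kje; have := tM _ _ jd kje; rewrite subnKC// => ->.
  by apply: ler_pM => //; exact: coef_le_gauss_norm.
have [->|A1] := eqVneq (gauss_norm d p) 0; first by rewrite mul0r gauss_norm_ge0.
have {A1}A0 : 0 < gauss_norm d p by rewrite lt_neqAle eq_sym A1.
have [->|B1] := eqVneq (gauss_norm e q) 0; first by rewrite mulr0 gauss_norm_ge0.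
have {B1}B0 : 0 < gauss_norm e q by rewrite lt_neqAle eq_sym B1.
have [i [id iE] imin] := gauss_norm_least A0.
have [j [je jE] jmin] := gauss_norm_least B0.
have spq : (size (p * q)%R <= (d + e).+1)%N.
  rewrite (leq_trans (size_polyMleq _ _))//.
  by have := leq_add sp sq; rewrite addSn addnS; case: (_ + _)%N.
apply: le_trans (coef_le_gauss_norm (i + j) spq).
set W := al ^+ (i + j) * be ^+ (d + e - (i + j)).
have main : abs (p`_i * q`_j) * W = gauss_norm d p * gauss_norm e q.
  by rewrite tM// iE jE.
have W0 : 0 < W.
  rewrite lt_neqAle [0 <= W]w0 andbT eq_sym; apply/eqP => W00.
  by move: main; rewrite W00 mulr0 => /eqP; rewrite eq_sym gt_eqF// mulr_gt0.
rewrite coefM.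
have hi : (i < (i + j).+1)%N by rewrite ltnS leq_addr.
rewrite (bigD1 (Ordinal hi))//= addKn addrC.
rewrite absv_isosceles ?main//.
rewrite -(ltr_pM2r W0) main -ltr_pdivlMr//; apply: absv_sum_lt => [|k].
  by apply: divr_gt0 => //; exact: mulr_gt0.
rewrite -val_eqE/= ltr_pdivlMr// => ki.
have kij : (k <= i + j)%N by rewrite -ltnS.
case E : ((k <= d) && (i + j - k <= e))%N; last first.
  by rewrite out// absv0 mul0r mulr_gt0.
case/andP: E => kd je'; have := tM _ _ kd je'; rewrite subnKC// -/W => ->.
have := ki; rewrite neq_ltn => /orP[lt|gt].
  apply: (@le_lt_trans _ _ (abs p`_k * (al ^+ k * be ^+ (d - k)) * gauss_norm e q)).
    by apply: ler_wpM2l => //; exact: coef_le_gauss_norm.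
  by rewrite ltr_pM2r// imin.
apply: (@le_lt_trans _ _ (gauss_norm d p * (abs q`_(i + j - k) * (al ^+ (i + j - k) * be ^+ (e - (i + j - k)))))).
  by apply: ler_wpM2r => //; exact: coef_le_gauss_norm.
by rewrite ltr_pM2l// jmin// ltn_subLR// ltn_add2r.
Qed.

End GaussNorm.

(** * The path from a point to infinity *)

Section JoinPoint.
Variables (R : realType) (K : closedFieldType) (abs : nonarchAbs R K).
Implicit Types p q : {poly K}.

Lemma gauss_norm_XaddC (al be : R) c : 0 <= al -> 0 <= be ->
  gauss_norm abs al be 1 ('X + c%:P) = Num.max (abs c * be) al.
Proof.
move=> al0 be0; rewrite /gauss_norm !big_ord_recl big_ord0 /=.
rewrite /bump/= !coefD !coefX !coefC/= add0r addr0 absv1 !expr0 !expr1 !mulr1 !mul1r.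
by rewrite [Num.max al 0]max_l.
Qed.

Lemma gauss_norm_Y (al be : R) : 0 <= be -> gauss_norm abs al be 1 1 = be.
Proof.
move=> be0; rewrite /gauss_norm !big_ord_recl big_ord0 /=.
rewrite /bump/= !coef1/= absv1 absv0 !expr0 !expr1 !mulr1 !mul1r mul0r maxxx.
by rewrite max_l.
Qed.

Variable a : K.

Lemma size_shift p : size (p \Po ('X + a%:P)) = size p.
Proof. by rewrite size_comp_poly2// size_XaddC. Qed.

Lemma XsubC_shift w : ('X - w%:P) \Po ('X + a%:P) = 'X + (a - w)%:P.
Proof. by rewrite comp_polyD comp_polyX -polyCN comp_polyC -addrA -polyCD. Qed.

Section Fixed.
Variable t : R.

Local Notation G := (gauss_norm abs `|t| `|1 - t|).

(** The normalization factor, the larger of the norms of [X = (X - aY) + aY] and [Y]. *)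
Definition join_max : R := Num.max (G 1 ('X + a%:P)) (G 1 1).

Lemma join_max_gt0 : 0 < join_max.
Proof.
rewrite /join_max gauss_norm_XaddC// gauss_norm_Y// !lt_max !normr_gt0 subr_eq0.
by have [->|] := eqVneq t 0; rewrite ?orbT// oner_eq0 orbT.
Qed.

(** The values of [join_pt] below: the normalized Gauss norm of the expansion at [a]. *)
Definition join_fun d p : R :=
  if (size p <= d.+1)%N then G d (p \Po ('X + a%:P)) / join_max ^+ d else 0.

Let jf_ge0 d p : 0 <= join_fun d p.
Proof.
rewrite /join_fun; case: ifP => // _.
by rewrite divr_ge0 ?gauss_norm_ge0 ?exprn_ge0 ?(ltW join_max_gt0).
Qed.

Let jf_out d p : (d.+1 < size p)%N -> join_fun d p = 0.
Proof. by rewrite /join_fun ltnNge => /negbTE ->. Qed.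

Let jfC c : join_fun 0 c%:P = abs c.
Proof.
by rewrite /join_fun size_polyC leq_b1 comp_polyC gauss_normC// expr0 divr1.
Qed.

Let jfM d e p q : (size p <= d.+1)%N -> (size q <= e.+1)%N ->
  join_fun (d + e) (p * q) = join_fun d p * join_fun e q.
Proof.
move=> sp sq; rewrite /join_fun sp sq.
have -> : (size (p * q)%R <= (d + e).+1)%N.
  rewrite (leq_trans (size_polyMleq _ _))//.
  by have := leq_add sp sq; rewrite addSn addnS; case: (_ + _)%N.
by rewrite comp_polyM gauss_normM ?size_shift// exprD invfM mulrACA.
Qed.

Let jfD d p q : (size p <= d.+1)%N -> (size q <= d.+1)%N ->
  join_fun d (p + q) <= Num.max (join_fun d p) (join_fun d q).
Proof.
move=> sp sq; rewrite /join_fun sp sq.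
have -> : (size (p + q)%R <= d.+1)%N.
  by apply: leq_trans (size_polyD p q) _; rewrite geq_max sp sq.
have M0 : 0 < (join_max ^+ d)^-1 by rewrite invr_gt0 exprn_gt0// join_max_gt0.
by rewrite -maxr_pMl ?(ltW M0)// ler_pM2r// comp_polyD gauss_normD ?size_shift.
Qed.

Let jf_normal : Num.max (join_fun 1 'X) (join_fun 1 1) = 1.
Proof.
rewrite /join_fun size_polyX size_poly1/= comp_polyX comp_polyC expr1.
by rewrite -maxr_pMl ?invr_ge0 ?(ltW join_max_gt0)// divff// gt_eqF// join_max_gt0.
Qed.

(** The point at time [t] of the path from [a] ([t = 0]) to infinity ([t = 1]): the
    Gauss norm giving [X - aY] and [Y] the norms [|t|] and [|1 - t|]. For
    [0 <= t < 1] it is the point of the closed disc of center [a] and radius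
    [t / (1 - t)]. The absolute values make it a total function of [t]. *)
Definition join_pt : berkP1 abs := BerkP1 jf_ge0 jf_out jfC jfM jfD jf_normal.

Lemma join_pt1 : join_pt 1%N 1 = `|1 - t| / join_max.
Proof. by rewrite /= /join_fun size_poly1/= comp_polyC gauss_norm_Y// expr1. Qed.

Lemma join_pt1_gt0 : t != 1 -> 0 < join_pt 1%N 1.
Proof. by move=> t1; rewrite join_pt1 divr_gt0 ?join_max_gt0// normr_gt0 subr_eq0 eq_sym. Qed.

Lemma join_pt_XsubC w :
  join_pt 1%N ('X - w%:P) = Num.max (abs (a - w) * `|1 - t|) `|t| / join_max.
Proof. by rewrite /= /join_fun size_XsubC/= XsubC_shift gauss_norm_XaddC// expr1. Qed.

Lemma anorm_join_XsubC w : t != 1 ->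
  anorm join_pt ('X - w%:P) = Num.max (abs (w - a)) (`|t| / `|1 - t|).
Proof.
move=> t1; rewrite (@anormE _ _ _ _ (join_pt1_gt0 t1) 1) ?size_XsubC// expr1.
have d0 : `|1 - t| != 0 by rewrite normr_eq0 subr_eq0 eq_sym.
rewrite join_pt_XsubC join_pt1 invf_div mulrA divfK ?gt_eqF ?join_max_gt0//.
by rewrite maxr_pMl ?invr_ge0// mulfK// absvB.
Qed.

End Fixed.

Lemma join_pt0 : join_pt 0 = classical_pt abs (Some a).
Proof.
by apply: classical_finP; rewrite join_pt_XsubC subrr absv0 mul0r normr0 maxxx mul0r.
Qed.

Lemma join_pt_inf : join_pt 1 = classical_pt abs None.
Proof. by apply: classical_infP; rewrite join_pt1 subrr normr0 mul0r. Qed.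

Lemma gauss_norm_continuous d p :
  continuous (fun t : R => gauss_norm abs `|t| `|1 - t| d p).
Proof.
rewrite /gauss_norm; elim: (index_enum _) => [|i r IHr].
  by under eq_fun do rewrite big_nil; move=> t; exact: cvg_cst.
under eq_fun do rewrite big_cons.
apply: max_fun_continuous => //= t.
apply: cvgM; first exact: cvg_cst.
have cX (f : R -> R) n : {for t, continuous f} -> {for t, continuous (fun u => f u ^+ n)}.
  by move=> cf; apply: (@continuous_comp _ _ _ f (fun y : R => y ^+ n)) => //; apply: exprn_continuous.
apply: cvgM; apply: cX; first exact: norm_continuous.
apply: cvg_norm; apply: cvgB; [exact: cvg_cst|exact: cvg_id].
Qed.

Lemma join_pt_continuous : continuous join_pt.
Proof.
apply: berk_continuousP => d p t; rewrite /= /join_fun; case: (size p <= d.+1)%N; last exact: cvg_cst.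
apply: cvgM; first exact: gauss_norm_continuous.
apply: cvgV; first by rewrite expf_neq0// gt_eqF// join_max_gt0.
apply: (@continuous_comp _ _ _ join_max (fun y => y ^+ d)); last by apply: exprn_continuous.
by move: t; apply: max_fun_continuous; exact: gauss_norm_continuous.
Qed.

Lemma join_path (A : set (berkP1 abs)) (t0 t1 : R) : t0 <= t1 ->
  (forall t, t0 <= t <= t1 -> A (join_pt t)) ->
  path_component R A (join_pt t0) (join_pt t1).
Proof.
move=> t01 h; exists (fun u : R => join_pt (t0 + u * (t1 - t0))); split.
- apply: continuous_subspaceT => u.
  apply: (@continuous_comp _ _ (berkP1 abs) (fun u : R => t0 + u * (t1 - t0)) join_pt u); last exact: join_pt_continuous.
  by apply: cvgD; [exact: cvg_cst|apply: cvgM; [exact: cvg_id|exact: cvg_cst]].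
- by rewrite mul0r addr0.
- by rewrite mul1r addrC subrK.
- by move=> w [u /=]; rewrite in_itv/= => /andP[u0 u1] <-; apply: h; nra.
Qed.

End JoinPoint.

(** * Discs and components *)

Section DiscPoint.
Variables (R : realType) (K : closedFieldType) (abs : nonarchAbs R K).
Implicit Types (p q : {poly K}) (s r : R).

(** The point of the closed disc of center [a] and radius [s >= 0]. *)
Definition disc_pt a s : berkP1 abs := join_pt abs a (s / (1 + s)).

Lemma disc_param s : 0 <= s ->
  [/\ s / (1 + s) != 1, `|s / (1 + s)| / `|1 - s / (1 + s)| = s & 0 <= s / (1 + s) < 1].
Proof.
move=> s0; have p0 : 0 < 1 + s by lra.
have lt1 : s / (1 + s) < 1 by rewrite ltr_pdivrMr// mul1r ltrDr.
have ge0 : 0 <= s / (1 + s) by rewrite divr_ge0// ltW.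
split; [by rewrite lt_eqF| |by rewrite ge0].
rewrite !ger0_norm ?subr_ge0 ?(ltW lt1)//.
have -> : 1 - s / (1 + s) = (1 + s)^-1 by field; rewrite gt_eqF.
by rewrite invrK divfK// gt_eqF.
Qed.

Lemma disc_pt1 a s : 0 <= s -> 0 < disc_pt a s 1%N 1.
Proof. by move=> /disc_param[s1 _ _]; apply: join_pt1_gt0. Qed.

Lemma anorm_disc_XsubC a s w : 0 <= s ->
  anorm (disc_pt a s) ('X - w%:P) = Num.max (abs (w - a)) s.
Proof. by move=> /disc_param[s1 E _]; rewrite anorm_join_XsubC// E. Qed.

Lemma join_ptE a t : 0 <= t < 1 -> join_pt abs a t = disc_pt a (t / (1 - t)).
Proof.
move=> /andP[t0 t1]; have p0 : 1 - t != 0 by rewrite subr_eq0 gt_eqF.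
rewrite /disc_pt; congr join_pt.
have -> : 1 + t / (1 - t) = (1 - t)^-1 by field.
by rewrite invrK divfK.
Qed.

Lemma disc_pt_center a b s : abs (a - b) <= s -> disc_pt a s = disc_pt b s.
Proof.
move=> ab; have s0 : 0 <= s by apply: le_trans ab; exact: absv_ge0.
apply: berk_eq_affine; rewrite ?disc_pt1// => w; rewrite !anorm_disc_XsubC//.
have sub c d : abs (c - d) <= s -> Num.max (abs (w - c)) s <= Num.max (abs (w - d)) s.
  move=> cd; rewrite ge_max [s <= _]le_max lexx orbT andbT.
  have -> : w - c = (w - d) + (d - c) by rewrite addrA subrK.
  apply: le_trans (absvD _ _ _) _; rewrite ge_max !le_max lexx/=.
  by rewrite absvB cd orbT.
by apply/eqP; rewrite eq_le !sub// absvB.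
Qed.

Lemma hnorm_XsubC_inf_gt0 (x : berkP1 abs) a : x 1%N 1 = 0 -> 0 < x 1%N ('X - a%:P).
Proof.
move=> x1; rewrite (hnorm_inf x1) ?size_XsubC// coefB coefX coefC/= subr0 absv1.
exact: ltr01.
Qed.

Lemma hnormB_continuous r p q d :
  continuous (fun x : berkP1 abs => x d p - r * x d q).
Proof.
have c1 := @hnorm_continuous R K abs d p; have c2 := @hnorm_continuous R K abs d q.
move=> x; apply: (cvgB (c1 x)).
exact: (cvgM (cvg_cst r) (c2 x)).
Qed.

Lemma open_hnorm_lt r p q d : open [set x : berkP1 abs | x d p < r * x d q].
Proof.
rewrite (_ : mkset _ = (fun x : berkP1 abs => x d p - r * x d q) @^-1` [set z | z < 0]).
  have /continuousP h := @hnormB_continuous r p q d; apply: h; exact: open_lt.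
by apply/funext => x /=; rewrite subr_lt0.
Qed.

Lemma open_hnorm_neq r p q d : open [set x : berkP1 abs | x d p != r * x d q].
Proof.
rewrite (_ : mkset _ = (fun x : berkP1 abs => x d p - r * x d q) @^-1` [set z | z != 0]).
  have /continuousP h := @hnormB_continuous r p q d; apply: h; exact: open_neq.
by apply/funext => x /=; rewrite subr_eq0.
Qed.

(** The boundary of the open disc of center [a] and radius [r] consists of
    [disc_pt a r] alone, so a connected set avoiding this point stays inside or
    outside the disc. *)
Lemma connected_disc a r (C : set (berkP1 abs)) : 0 < r -> connected C ->
  C (classical_pt abs (Some a)) -> ~ C (disc_pt a r) ->
  forall x, C x -> x 1%N ('X - a%:P) < r * x 1%N 1.
Proof.
move=> r0 Cc Ca CP.
pose D := [set x : berkP1 abs | x 1%N ('X - a%:P) < r * x 1%N 1].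
(* E is open, disjoint from D, and D, E and disc_pt a r cover the line *)
pose E := [set x : berkP1 abs | x 1%N 1 < r^-1 * x 1%N ('X - a%:P)] `|`
  \bigcup_(w in [set w | r <= abs (w - a)])
     [set x : berkP1 abs | x 1%N ('X - w%:P) != abs (w - a) * x 1%N 1].
have oE : open E.
  apply: openU; first exact: open_hnorm_lt.
  by apply: bigcup_open => w _; exact: open_hnorm_neq.
have x1D (x : berkP1 abs) : D x -> 0 < x 1%N 1.
  move=> Dx; have [x1|//] := hnorm_Y_eq0_or_gt0 x.
  by move: Dx; rewrite /D /= x1 mulr0 ltNge hnorm_ge0.
have aE (x : berkP1 abs) w : 0 < x 1%N 1 -> x 1%N ('X - w%:P) = anorm x ('X - w%:P) * x 1%N 1.
  by move=> x1; rewrite (hnormE x1 (d:=1)) ?size_XsubC// expr1.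
have XE w : 'X - w%:P = ('X - a%:P) + (a - w)%:P by rewrite polyCB addrA subrK.
suff : C `&` D = C by move=> CD x; rewrite -CD => -[].
apply: Cc.
- exists (classical_pt abs (Some a)); split=> //; rewrite /D.
  change (classical_pt abs (Some a) 1%N ('X - a%:P) < r * classical_pt abs (Some a) 1%N 1).
  by rewrite classical_root_eq0 ?hornerXsubC ?subrr// mulr_gt0// classical_fin1.
- by exists D => //; exact: open_hnorm_lt.
- exists (~` E); first exact: open_closedC.
  apply/seteqP; split=> x [Cx].
    move=> Dx; split=> //; have x1 := x1D _ Dx; move: (Dx); rewrite /D /= => Dx' [/=|].
      by rewrite ltr_pdivlMl// ltNge (ltW Dx').
    move=> [w /= rw /negP]; apply.
    rewrite aE// XE anorm_isosceles//; first by rewrite anormC// absvB.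
    rewrite anormC// absvB (lt_le_trans _ rw)//.
    by move: Dx'; rewrite aE// ltr_pM2r.
  move=> nE; split=> //; rewrite /D /= ltNge; apply/negP => ge.
  have le : x 1%N ('X - a%:P) <= r * x 1%N 1.
    rewrite leNgt; apply/negP => lt; apply: nE; left => /=.
    by rewrite ltr_pdivlMl.
  have eq : x 1%N ('X - a%:P) = r * x 1%N 1 by apply/eqP; rewrite eq_le le ge.
  have x1 : 0 < x 1%N 1.
    have [x1|//] := hnorm_Y_eq0_or_gt0 x.
    by have := hnorm_XsubC_inf_gt0 a x1; rewrite eq x1 mulr0 ltxx.
  have an : anorm x ('X - a%:P) = r.
    by move: eq; rewrite aE// => /mulIf; apply; rewrite gt_eqF.
  apply: CP; suff <- : x = disc_pt a r by [].
  apply: berk_eq_affine => //; first by apply: disc_pt1; exact: ltW.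
  move=> w; rewrite anorm_disc_XsubC ?(ltW r0)//.
  have [rw|wr] := leP r (abs (w - a)).
    have : x 1%N ('X - w%:P) = abs (w - a) * x 1%N 1.
      apply/eqP; apply: contrapT => /negP h; apply: nE; right; by exists w.
    by rewrite aE// => /mulIf ->//; rewrite gt_eqF.
  rewrite XE addrC anorm_isosceles ?anormC// an.
  by rewrite absvB.
Qed.

Section Component.
Variables (P x0 : berkP1 abs).

Local Notation U := (path_component R (~` [set P]) x0).

Variable a : K.
Hypotheses (Ua : U (classical_pt abs (Some a))) (Uinf : ~ U (classical_pt abs None)).

(** If a path-component of the complement of [P] contains [a] but not infinity, then
    [P] lies on the path from [a] to infinity. In what follows [P] is the point of
    the disc of radius [r = tau / (1 - tau)], infinite when [tau = 1], and the
    condition [s < r] is written [s * (1 - tau) < tau]. *)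
Lemma join_between : exists2 tau : R, 0 < tau <= 1 & P = join_pt abs a tau.
Proof.
have nP : classical_pt abs (Some a) <> P by have [] := path_componentW Ua.
apply: contrapT => h; apply: Uinf; apply: path_component_trans Ua _.
rewrite -join_pt0 -(join_pt_inf abs a); apply: join_path => // t /andP[t0 t1] /= E.
apply: h; exists t => //; rewrite t1 andbT lt_neqAle t0 andbT.
by apply/eqP => t00; apply: nP; rewrite -join_pt0 t00.
Qed.

Variable tau : R.
Hypotheses (tau01 : 0 < tau <= 1) (Ptau : P = join_pt abs a tau).

Lemma disc_pt_neq b s : 0 <= s -> abs (b - a) * (1 - tau) < tau -> s * (1 - tau) < tau ->
  disc_pt b s <> P.
Proof.
move=> s0 ba st; have /andP[tau0 tau1] := tau01; rewrite Ptau => E.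
have [t1|t1] := eqVneq tau 1.
  have := disc_pt1 b s0; rewrite E t1 join_pt1 subrr normr0 mul0r ltxx //.
have t1' : 0 < 1 - tau by rewrite subr_gt0 lt_neqAle t1.
have : anorm (disc_pt b s) ('X - a%:P) = tau / (1 - tau).
  by rewrite E anorm_join_XsubC// subrr absv0 !gtr0_norm// max_r// divr_ge0 ?ltW.
rewrite anorm_disc_XsubC// => /eqP; rewrite lt_eqF//.
by rewrite gt_max !ltr_pdivlMr// st absvB ba.
Qed.

Lemma disc_pt_in_component s : 0 <= s -> s * (1 - tau) < tau -> U (disc_pt a s).
Proof.
move=> s0 st; apply: path_component_trans Ua _.
have [_ _ /andP[u0 u1]] := disc_param s0.
have p0 : 0 < 1 + s by lra.
rewrite -join_pt0; apply: join_path => // t /andP[t0 tu] /=.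
have t1 := le_lt_trans tu u1.
rewrite join_ptE ?t0//; apply: disc_pt_neq.
- by rewrite divr_ge0// subr_ge0 ltW.
- by rewrite subrr absv0 mul0r; case/andP: tau01.
- move: tu; rewrite ler_pdivlMr// mulrDr mulr1 -lerBrDr => tu.
  rewrite (le_lt_trans _ st)// ler_wpM2r ?subr_ge0//; first by case/andP: tau01.
  by rewrite ler_pdivrMr ?subr_gt0//; lra.
Qed.

(** With [component_in_disc]: the classical points of the component are those of the
    open disc of center [a] and radius [r]. *)
Lemma classical_in_component w : abs (w - a) * (1 - tau) < tau ->
  U (classical_pt abs (Some w)).
Proof.
move=> wa; apply: path_component_trans (disc_pt_in_component (absv_ge0 _ _) wa) _.
rewrite (@disc_pt_center a w); last by rewrite absvB.
set s := abs (w - a); have s0 : 0 <= s by exact: absv_ge0.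
apply: path_component_sym; have [_ _ /andP[u0 u1]] := disc_param s0.
have p0 : 0 < 1 + s by lra.
rewrite -join_pt0; apply: join_path => // t /andP[t0 tu] /=.
have t1 := le_lt_trans tu u1.
rewrite join_ptE ?t0//; apply: disc_pt_neq => //.
- by rewrite divr_ge0// subr_ge0 ltW.
- move: tu; rewrite ler_pdivlMr// mulrDr mulr1 -lerBrDr => tu.
  rewrite (le_lt_trans _ wa)// ler_wpM2r ?subr_ge0//; first by case/andP: tau01.
  by rewrite ler_pdivrMr ?subr_gt0//; rewrite -/s; lra.
Qed.

Lemma component_in_disc w : U (classical_pt abs (Some w)) -> abs (w - a) * (1 - tau) < tau.
Proof.
move=> Uw; have /andP[tau0 tau1] := tau01.
have [t1|t1] := eqVneq tau 1; first by rewrite t1 subrr mulr0 ltr01.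
have t1' : 0 < 1 - tau by rewrite subr_gt0 lt_neqAle t1.
have [C [Cc Ca Cw CP]] := path_component_connected (path_component_trans (path_component_sym Ua) Uw).
have PE : P = disc_pt a (tau / (1 - tau)).
  by rewrite Ptau join_ptE// (ltW tau0) lt_neqAle t1.
have r0 : 0 < tau / (1 - tau) by rewrite divr_gt0.
have := @connected_disc a _ C r0 Cc Ca _ _ Cw; rewrite -PE => /(_ (fun h => CP _ h erefl)).
have w1 := classical_fin1 abs w.
rewrite (@hnormE _ _ _ _ w1 1) ?size_XsubC// expr1 ltr_pM2r// anorm_classical !hornerE.
by rewrite ltr_pdivlMr.
Qed.

End Component.
End DiscPoint.

(** * Polynomials on discs *)

Section PolyNorms.
Variables (R : realType) (K : closedFieldType) (abs : nonarchAbs R K).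
Implicit Types (p q f g : {poly K}) (s r : R) (a y w c : K).

Local Notation disc_pt := (disc_pt abs).

Lemma anorm_disc_split a s (l : K) (rs : seq K) : 0 <= s ->
  anorm (disc_pt a s) (l *: \prod_(z <- rs) ('X - z%:P)) =
  abs l * \prod_(z <- rs) Num.max (abs (z - a)) s.
Proof.
move=> s0; rewrite anormZ ?disc_pt1// anorm_prod ?disc_pt1//; congr (_ * _).
by apply: eq_bigr => z _; rewrite anorm_disc_XsubC.
Qed.

Lemma anorm_disc_gt0 a s p : 0 < s -> p != 0 -> 0 < anorm (disc_pt a s) p.
Proof.
move=> s0 p0; have [rs Ep] := poly_split p.
rewrite Ep anorm_disc_split ?ltW// mulr_gt0 ?absv_gt0 ?lead_coef_eq0//.
by apply: prodr_gt0 => z _; rewrite lt_max s0 orbT.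
Qed.

Lemma horner_le_disc a s p : 0 <= s -> abs p.[a] <= anorm (disc_pt a s) p.
Proof.
move=> s0; have [rs Ep] := poly_split p.
rewrite Ep anorm_disc_split// hornerZ absvM horner_prod absv_prod.
apply: ler_wpM2l; first exact: absv_ge0.
by apply: ler_prod => z _; rewrite absv_ge0 !hornerE absvB le_max lexx.
Qed.

(** A polynomial without zeros in the open disc has constant absolute value on it. *)
Lemma horner_eq_disc a s p : 0 <= s -> (forall w, root p w -> s <= abs (w - a)) ->
  abs p.[a] = anorm (disc_pt a s) p.
Proof.
move=> s0 h; have [->|p0] := eqVneq p 0.
  by rewrite horner0 absv0 -[0 in RHS]/(0%:P) anormC ?absv0 ?disc_pt1.
have [rs Ep] := poly_split p.
have hr w : w \in rs -> s <= abs (w - a).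
  by move=> wr; apply: h; rewrite Ep rootZ ?lead_coef_eq0// root_prod_XsubC.
rewrite Ep anorm_disc_split// hornerZ absvM horner_prod absv_prod; congr (_ * _).
by apply: eq_big_seq => z /hr sz; rewrite !hornerE absvB max_l.
Qed.

Lemma horner_lt_disc a s p w : p != 0 -> root p w -> abs (w - a) < s ->
  abs p.[a] < anorm (disc_pt a s) p.
Proof.
move=> p0 /factor_theorem[q Eq] ws; have s0 : 0 < s by apply: le_lt_trans ws; exact: absv_ge0.
have q0 : q != 0 by apply: contraNneq p0 => q0; rewrite Eq q0 mul0r.
rewrite Eq hornerM absvM anormM ?disc_pt1 ?(ltW s0)// anorm_disc_XsubC ?(ltW s0)//.
rewrite !hornerE max_r ?(ltW ws)//; apply: (@le_lt_trans _ _ (anorm (disc_pt a s) q * abs (a - w))).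
  by apply: ler_wpM2r; [exact: absv_ge0|apply: horner_le_disc; exact: ltW].
by rewrite ltr_pM2l ?anorm_disc_gt0// absvB.
Qed.

Lemma anorm_disc_mono a s r p : 0 <= s -> s <= r ->
  anorm (disc_pt a s) p <= anorm (disc_pt a r) p.
Proof.
move=> s0 sr; have r0 := le_trans s0 sr; have [rs Ep] := poly_split p.
rewrite Ep !anorm_disc_split//; apply: ler_wpM2l; first exact: absv_ge0.
apply: ler_prod => z _; rewrite le_max s0 orbT/= ge_max !le_max lexx/=.
by rewrite sr orbT.
Qed.

(** The function [s |-> s * |g|_(a,s)] is continuous and vanishes at 0. *)
Lemma radius_exists a g (C s1 : R) : 0 < C -> 0 <= s1 ->
  C < s1 * anorm (disc_pt a s1) g ->
  exists s, [/\ 0 < s, s < s1 & s * anorm (disc_pt a s) g = C].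
Proof.
move=> C0 s10 hC; have [rs Eg] := poly_split g.
pose F (s : R) := s * (abs (lead_coef g) * \prod_(z <- rs) Num.max (abs (z - a)) s).
have FE s : 0 <= s -> s * anorm (disc_pt a s) g = F s.
  by move=> s0; rewrite {1}Eg anorm_disc_split.
have pc (l : seq K) : continuous (fun s : R => \prod_(z <- l) Num.max (abs (z - a)) s).
  elim: l => [|z l IHl].
    by under eq_fun do rewrite big_nil; move=> s; exact: cvg_cst.
  under eq_fun do rewrite big_cons.
  move=> s; apply: cvgM; last exact: IHl.
  by move: s; apply: max_fun_continuous => s; [exact: cvg_cst|exact: cvg_id].
have Fc : continuous F.
  move=> s; apply: cvgM; first exact: cvg_id.
  by apply: cvgM; [exact: cvg_cst|exact: pc].
have [] := @IVT R F 0 s1 C s10; first by apply: continuous_subspaceT => u; apply: Fc.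
  have F0 : F 0 = 0 by rewrite /F mul0r.
  by rewrite ge_min le_max F0 (ltW C0) -(FE _ s10) (ltW hC) orbT.
move=> s; rewrite in_itv/= => /andP[s0 ss1] Fs; exists s; split; last by rewrite FE.
  by rewrite lt_neqAle s0 andbT eq_sym; apply: contraTneq C0 => sz; rewrite -Fs /F sz mul0r ltxx.
rewrite lt_neqAle ss1 andbT; apply: contraTneq hC => sz.
by rewrite -sz FE// Fs ltxx.
Qed.

Lemma radius_large a g (C : R) : g != 0 ->
  exists2 s, 0 <= s & C < s * anorm (disc_pt a s) g.
Proof.
move=> g0; have [rs Eg] := poly_split g.
have l0 : 0 < abs (lead_coef g) by rewrite absv_gt0 lead_coef_eq0.
pose s := Num.max 1 (C / abs (lead_coef g) + 1).
have s1 : 1 <= s by rewrite le_max lexx.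
have s0 : 0 <= s by lra.
exists s => //; rewrite Eg anorm_disc_split//.
apply: (@lt_le_trans _ _ (s * abs (lead_coef g))).
  by rewrite -ltr_pdivrMr// lt_max ltrDl ltr01 orbT.
apply: ler_wpM2l => //; rewrite ler_peMr ?(ltW l0)//.
rewrite -[leLHS](@big1 R 1 *%R _ rs xpredT (fun=> 1))//.
by apply: ler_prod => z _; rewrite ler01 le_max s1 orbT.
Qed.

(** The radius is in the value group: by [anorm_disc_split] the equation has the form
    [|B| * s ^ k.+1 = |n|] with [B] in [K]. *)
Lemma radius_value a g (s : R) n : 0 < s -> g != 0 ->
  s * anorm (disc_pt a s) g = abs n -> exists l, abs l = s.
Proof.
move=> s0 g0; have [rs Eg] := poly_split g.
rewrite Eg anorm_disc_split ?ltW//.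
have [k [A A0 ->]] : exists k, exists2 A : K, A != 0 &
    \prod_(z <- rs) Num.max (abs (z - a)) s = abs A * s ^+ k.
  elim: (rs) => [|z l [k [A A0 IH]]].
    by exists 0%N, 1; rewrite ?oner_eq0// big_nil absv1 expr0 mulr1.
  rewrite big_cons; have [h|h] := leP (abs (z - a)) s.
    by exists k.+1, A => //; rewrite IH exprS mulrCA.
  exists k, ((z - a) * A); last by rewrite IH absvM mulrA.
  by rewrite mulf_neq0// -(absv_gt0 abs) (lt_trans s0).
set B := lead_coef g * A; have B0 : B != 0 by rewrite mulf_neq0 ?lead_coef_eq0.
move=> E; have {}E : s ^+ k.+1 = abs (n / B).
  apply: (mulfI (x := abs B)); first by rewrite absv_eq0.
  rewrite -absvM [B * _]mulrC divfK// -E.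
  by rewrite /B absvM exprS; ring.
have [l] := @solve_monicpoly K k.+1 (fun i => if i is 0%N then n / B else 0) isT.
rewrite big_ord_recl big1 => [|i _]; last by rewrite mul0r.
rewrite addr0 expr0 mulr1 => El; exists l.
have := congr1 abs El; rewrite absvX -E => /eqP.
by rewrite eqrXn2 ?absv_ge0 ?ltW// => /eqP.
Qed.

(** Finitely many open discs of radius 1 do not cover the closed unit disc. *)
Lemma avoid_discs (T : seq K) : exists2 t, abs t <= 1 & forall u, u \in T -> 1 <= abs (t - u).
Proof.
(* t is a root of the product of the X - u, minus 1, over the u in the closed unit
   disc; 0 is added to make the degree positive *)
pose T' := 0 :: [seq u <- T | abs u <= 1].
have T'1 u : u \in T' -> abs u <= 1.
  by rewrite inE => /orP[/eqP->|]; rewrite ?absv0 ?ler01// mem_filter => /andP[].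
pose q := \prod_(u <- T') ('X - u%:P) - 1.
have [|t /eqP] := @closed_rootP K q _.
  rewrite /q size_polyDl ?size_polyN ?size_poly1 size_prod_XsubC//.
rewrite /q hornerD hornerN hornerC horner_prod => /eqP; rewrite subr_eq0 => /eqP /(congr1 abs).
rewrite absv_prod absv1 => E.
have E' : \prod_(u <- T') abs (t - u) = 1.
  by rewrite -[RHS]E; apply: eq_bigr => u _; rewrite !hornerE.
have t1 : abs t <= 1.
  rewrite leNgt; apply/negP => t1.
  have : 1 < \prod_(u <- T') abs (t - u).
    rewrite (eq_big_seq (fun=> abs t)) => [|u /T'1 u1]; last first.
      have ut : abs (- u) < abs t by rewrite absvN (le_lt_trans u1).
      by rewrite addrC (absv_isosceles ut).
    rewrite big_const_seq count_predT /= -/(iterop _ _ _ _).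
    elim: (size _) => [|n IHn] /=; first by rewrite mulr1.
    by apply: (lt_trans IHn); rewrite -[ltLHS]mul1r ltr_pM2r// (lt_trans ltr01 IHn).
  by rewrite E' ltxx.
exists t => // u uT; have [u1|u1] := leP (abs u) 1; last first.
  by rewrite absv_isosceles ?absvN ?(le_lt_trans t1)// ltW.
have uT' : u \in T' by rewrite inE mem_filter u1 uT orbT.
rewrite -E' (big_rem u uT').
have : {subset rem u T' <= T'} by exact: mem_rem.
move: (rem u T') => l lT /=; rewrite ler_piMr ?absv_ge0//.
rewrite big_seq; apply: prodr_ile1 => v /lT /T'1 v1; rewrite absv_ge0/=.
by apply: le_trans (absvD _ _ _) _; rewrite absvN ge_max t1 v1.
Qed.

Lemma gap_above (s : R) (l : seq R) : exists2 r, s < r & forall u, u \in l -> s < u -> r < u.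
Proof.
elim: l => [|u l [r sr IH]]; first by exists (s + 1) => //; rewrite ltrDl ltr01.
have [us|su] := leP u s.
  exists r => // v; rewrite inE => /orP[/eqP->|]; last exact: IH.
  by rewrite ltNge us.
exists (Num.min r ((s + u) / 2)); first by rewrite lt_min sr/=; lra.
move=> v; rewrite inE => /orP[/eqP-> _|vl sv]; first by rewrite gt_min; apply/orP; right; lra.
by rewrite gt_min IH.
Qed.

(** A classical point of the closed disc has the same values as [disc_pt a s] on given
    polynomials, if it avoids finitely many open discs of radius [s]. *)
Lemma generic_classical a s (L : seq {poly K}) : 0 <= s ->
  exists W : seq K, forall y, abs (y - a) <= s -> (forall w, w \in W -> s <= abs (w - y)) ->
    forall p, p \in L -> anorm (classical_pt abs (Some y)) p = anorm (disc_pt a s) p.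
Proof.
move=> s0; elim: L => [|p L [W IH]]; first by exists [::].
have [rs Ep] := poly_split p.
exists (rs ++ W) => y ya yW q; rewrite inE => /orP[/eqP->|qL]; last first.
  by apply: IH => // w wW; apply: yW; rewrite mem_cat wW orbT.
rewrite anorm_classical (@disc_pt_center _ _ _ a y) ?(absvB _ a)//.
have [->|p0] := eqVneq p 0.
  by rewrite horner0 absv0 -[0 in RHS]/(0%:P) anormC ?absv0 ?disc_pt1.
apply: horner_eq_disc => // w; rewrite Ep rootZ ?lead_coef_eq0// root_prod_XsubC => wr.
by apply: yW; rewrite mem_cat wr.
Qed.

Lemma nbhs_disc_generic a s (V : set (berkP1 abs)) : 0 <= s -> nbhs (disc_pt a s) V ->
  exists W : seq K, forall y, abs (y - a) <= s -> (forall w, w \in W -> s <= abs (w - y)) ->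
    V (classical_pt abs (Some y)).
Proof.
move=> s0 /nbhs_hnorm_eq[L LV].
have [W hW] := @generic_classical a s ('X :: [seq i.2 | i <- L]) s0.
exists W => y ya yW; apply: LV => -[d p] dpL.
change (classical_pt abs (Some y) d p = disc_pt a s d p).
have [sp|sp] := leqP (size p) d.+1; last by rewrite !hnorm_out.
have c1 := classical_fin1 abs y; have d1 := disc_pt1 abs a s0.
rewrite (hnormE c1 sp) (hnormE d1 sp) (hW y)//; last first.
  by rewrite inE; apply/orP; right; apply/mapP; exists (d, p).
congr (_ * _ ^+ _).
have := etrans (anorm_X_max c1) (esym (anorm_X_max d1)).
rewrite (hW y)// ?mem_head// => /mulfI; apply.
by rewrite gt_eqF// lt_max ltr01 orbT.
Qed.

End PolyNorms.

(** * Local analysis at the repelling fixed point *)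

Section FormCompLinear.
Variables (K : fieldType) (f g : {poly K}).

Lemma form_comp_Y : form_comp f g 1 1 = g.
Proof. by rewrite (@form_compXn _ f g 1 0)// subn0 expr0 expr1 mul1r. Qed.

Lemma form_comp_X : form_comp f g 1 'X = f.
Proof. by rewrite (@form_compXn _ f g 1 1)// subnn expr0 expr1 mulr1. Qed.

Lemma form_comp_XsubC w : form_comp f g 1 ('X - w%:P) = f - w *: g.
Proof.
rewrite -polyCN form_compD form_comp_X -[(- w)%:P]mulr1 mul_polyC form_compZ form_comp_Y.
by rewrite scaleNr.
Qed.

End FormCompLinear.

Section RatFunMap.
Variables (R : realType) (K : closedFieldType) (abs : nonarchAbs R K) (phi : ratFun K).

Local Notation f := (ratNum phi).
Local Notation g := (ratDen phi).
Local Notation e := (ratFun_deg phi).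

Lemma ratFun_mapE (x : berkP1 abs) d (p : {poly K}) : (size p <= d.+1)%N ->
  ratFun_map phi x d p = x (d * e)%N (form_comp f g d p) / ratFun_max phi x ^+ d.
Proof. by move=> sp; rewrite /= /ratFun_map_fun sp. Qed.

Lemma ratFun_map1 (x : berkP1 abs) (p : {poly K}) : (size p <= 2)%N ->
  ratFun_map phi x 1%N p = x e (form_comp f g 1 p) / ratFun_max phi x.
Proof. by move=> sp; rewrite ratFun_mapE// mul1n expr1. Qed.

Lemma ratFun_map_XsubC (x : berkP1 abs) w :
  ratFun_map phi x 1%N ('X - w%:P) = x e (f - w *: g) / ratFun_max phi x.
Proof. by rewrite ratFun_map1 ?size_XsubC// form_comp_XsubC. Qed.

Lemma ratFun_map_Y (x : berkP1 abs) :
  ratFun_map phi x 1%N 1 = x e g / ratFun_max phi x.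
Proof. by rewrite ratFun_map1 ?size_poly1// form_comp_Y. Qed.

Lemma size_num_sub_den c : (size (f - c *: g)%R <= e.+1)%N.
Proof.
apply: leq_trans (size_polyD _ _) _; rewrite geq_max size_num size_polyN.
by apply: leq_trans (size_scale_leq _ _) (size_den phi).
Qed.

(** The numerator and denominator have no common zero. *)
Lemma num_den_root a : g.[a] = 0 -> f.[a] != 0.
Proof.
move=> ga; apply: (coprimep_root (q := f) (p := g)); last exact/eqP.
by rewrite coprimep_sym ratFun_coprime.
Qed.

End RatFunMap.

Section Core.
Variables (R : realType) (K : closedFieldType) (abs : nonarchAbs R K) (phi : ratFun K).

Local Notation f := (ratNum phi).
Local Notation g := (ratDen phi).
Local Notation e := (ratFun_deg phi).
Local Notation N := (f - 'X * g).
Local Notation disc_pt := (disc_pt abs).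

(** The pole [a], and the radius [s] at which the displacement [|N(a)| / |g|_s] equals
    [s]; the fixed points are farther than [s] from [a]. *)
Section RepellingPoint.
Variables (a l : K) (s : R).
Hypotheses (s0 : 0 < s) (ls : abs l = s) (ga : g.[a] = 0).
Hypothesis Nroot : forall w, root N w -> s < abs (w - a).
Hypothesis sN : s * anorm (disc_pt a s) g = abs N.[a].

Local Notation Q := (disc_pt a s).
Local Notation B := (anorm Q g).

Let s0' : 0 <= s := ltW s0.
Let Q1 : 0 < Q 1%N 1 := disc_pt1 abs a s0'.

Let B0 : 0 < B.
Proof. by rewrite anorm_disc_gt0// ratDen_neq0. Qed.

Let combE c : f - c *: g = ('X - c%:P) * g + N.
Proof. by rewrite -mul_polyC; ring. Qed.

Let Nx x : abs (x - a) <= s -> abs N.[x] = s * B.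
Proof.
move=> xa; have Nr w : root N w -> s <= abs (w - x).
  move=> /Nroot sw; have -> : w - x = (a - x) + (w - a) by ring.
  by rewrite absv_isosceles ?ltW// absvB (le_lt_trans xa).
rewrite (horner_eq_disc s0' Nr) -(@disc_pt_center _ _ _ a) ?(absvB _ a)//.
rewrite sN; symmetry; apply: horner_eq_disc => // w /Nroot; exact: ltW.
Qed.

Let fa : abs f.[a] = s * B.
Proof. by rewrite -(@Nx a) ?subrr ?absv0// !hornerE ga mulr0 oppr0 addr0. Qed.

Let NQ : anorm Q N = s * B.
Proof.
by rewrite sN; symmetry; apply: horner_eq_disc => // w /Nroot; exact: ltW.
Qed.

(** There is no cancellation in [f - c g = (z - c) g + N]: when both terms have norm
    [s * |g|], the value of the sum at [a], a zero of [g], already has this norm. *)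
Lemma anorm_num_sub_den c : anorm Q (f - c *: g) = Num.max (abs (c - a)) s * B.
Proof.
have [ca|ca] := leP (abs (c - a)) s; last first.
  rewrite combE addrC anorm_isosceles// anormM// anorm_disc_XsubC// ?NQ.
    by rewrite max_l// ltW.
  by rewrite max_l ?(ltW ca)// ltr_pM2r.
apply/eqP; rewrite eq_le; apply/andP; split.
  rewrite combE (le_trans (anormD Q1 _ _))// ge_max NQ lexx andbT.
  by rewrite anormM// anorm_disc_XsubC// max_r.
rewrite -fa (le_trans _ (horner_le_disc abs a _ s0'))//.
by rewrite !hornerE ga mulr0 oppr0 addr0.
Qed.

Lemma disc_pt_fixed : ratFun_map phi Q = Q.
Proof.
have m0 := ratFun_max_gt0 phi Q.
have y1 : 0 < ratFun_map phi Q 1%N 1.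
  by rewrite ratFun_map_Y (hnormE Q1 (size_den phi)) divr_gt0// mulr_gt0// exprn_gt0.
apply: berk_eq_affine => // w; rewrite anorm_disc_XsubC//.
rewrite (anormE y1 (d := 1)) ?size_XsubC// ratFun_map_XsubC ratFun_map_Y.
rewrite (hnormE Q1 (size_den phi)) (hnormE Q1 (size_num_sub_den phi w)) anorm_num_sub_den expr1.
have k0 : Q 1%N 1 ^+ e != 0 by rewrite expf_neq0 ?gt_eqF.
have B1 : B != 0 by rewrite gt_eqF.
move: m0 => /lt0r_neq0; move: k0; move: (ratFun_max _ _) (Q 1%N 1 ^+ e) => m k k0 m0.
by field; rewrite B1 k0 m0.
Qed.

Lemma disc_pt_hyperbolic : hyperbolic Q.
Proof.
move=> [[z|] _ E]; last by have := Q1; rewrite -E classical_inf1 ltxx.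
have := anorm_disc_XsubC abs a z s0'; rewrite -E anorm_classical !hornerE subrr absv0.
by move=> /eqP; rewrite lt_eqF// lt_max s0 orbT.
Qed.

(** At a radius [r] slightly larger than [s], the term [(z - c) g] dominates [N], and
    it has two zeros in the disc, [c] and [a]. So from [s] to [r] the norm of
    [f - c g] grows at least by the factor [(r / s) ^ 2]; its number of zeros in the
    closed disc is the exponent of [r / s]. *)
Lemma two_preimages c : abs (c - a) <= s -> exists y1 y2 q,
  [/\ abs (y1 - a) <= s, abs (y2 - a) <= s &
      f - c *: g = ('X - y1%:P) * (('X - y2%:P) * q)].
Proof.
move=> ca; have [rs Ep] := poly_split (f - c *: g).
have [Nl EN] := poly_split N.
have [r sr gap] := gap_above s ([seq abs (y - a) | y <- rs ++ Nl]).
have r0 : 0 < r := lt_trans s0 sr; have r0' := ltW r0.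
have R1 : 0 < disc_pt a r 1%N 1 by exact: disc_pt1.
have N0 : N != 0.
  apply/eqP => NE; have := fa; rewrite -[f.[a]](_ : N.[a] = _); last by rewrite !hornerE ga mulr0 oppr0 addr0.
  by rewrite NE horner0 absv0 => /eqP; rewrite eq_sym gt_eqF// mulr_gt0.
have gr y : y \in rs -> s < abs (y - a) -> r < abs (y - a).
  by move=> yr; apply: gap; apply/mapP; exists y => //; rewrite mem_cat yr.
have Nr w : root N w -> r < abs (w - a).
  move=> rw; apply: gap (Nroot rw); apply/mapP; exists w => //.
  by move: rw; rewrite {1}EN rootZ ?lead_coef_eq0// root_prod_XsubC mem_cat orbC => ->.
have NR : anorm (disc_pt a r) N = s * B.
  by rewrite sN; symmetry; apply: horner_eq_disc => // w /Nr; exact: ltW.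
have gR : r / s * B <= anorm (disc_pt a r) g.
  have /factor_theorem[g1 Eg] : root g a by exact/eqP.
  rewrite Eg !anormM// !anorm_disc_XsubC// subrr absv0 !max_r//.
  have -> : r / s * (anorm Q g1 * s) = anorm Q g1 * r by field; rewrite gt_eqF.
  by apply: ler_wpM2r => //; apply: anorm_disc_mono => //; exact: ltW.
have cR : anorm (disc_pt a r) (f - c *: g) = r * anorm (disc_pt a r) g.
  rewrite combE addrC anorm_isosceles ?anormM// anorm_disc_XsubC// max_r ?(le_trans ca) ?(ltW sr)//.
  rewrite NR; apply: (@lt_le_trans _ _ (r * B)); first by rewrite ltr_pM2r.
  apply: ler_wpM2l => //; apply: le_trans gR.
  by rewrite ler_peMl ?(ltW B0)// ler_pdivlMr// mul1r ltW.
have cS : anorm Q (f - c *: g) = s * B by rewrite anorm_num_sub_den max_r.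
pose P := [pred y | abs (y - a) <= s].
have ratio : anorm (disc_pt a r) (f - c *: g) = anorm Q (f - c *: g) * (r / s) ^+ count P rs.
  rewrite Ep !anorm_disc_split// -mulrA; congr (_ * _).
  elim: (rs) gr => [|z t IHt] gr; first by rewrite !big_nil /= expr0 mulr1.
  rewrite !big_cons /= IHt => [|y yt]; last by apply: gr; rewrite inE yt orbT.
  have [zs|zs] := leP (abs (z - a)) s.
    rewrite max_r ?(le_trans zs) ?(ltW sr)// add1n exprS.
    by field; rewrite gt_eqF.
  by rewrite max_l ?mulrA// ltW// gr// mem_head.
have rs1 : 1 < r / s by rewrite ltr_pdivlMr// mul1r.
have k2 : (2 <= count P rs)%N.
  have h : r * (r / s * B) <= s * B * (r / s) ^+ count P rs.
    by rewrite -cS -ratio cR ler_wpM2l.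
  have sB0 : 0 < s * B by rewrite mulr_gt0.
  suff : (r / s) ^+ 2 <= (r / s) ^+ count P rs by rewrite ler_eXn2l.
  rewrite -(ler_pM2r sB0) [(r / s) ^+ count P rs * _]mulrC; apply: le_trans h.
  by rewrite (_ : r * (r / s * B) = (r / s) ^+ 2 * (s * B))//; field; rewrite gt_eqF.
have Eprod : \prod_(z <- rs) ('X - z%:P) =
    \prod_(z <- [seq z <- rs | P z]) ('X - z%:P) * \prod_(z <- [seq z <- rs | ~~ P z]) ('X - z%:P).
  by rewrite [LHS](bigID P) !big_filter.
move: k2 Eprod; rewrite -size_filter.
have fP y : y \in [seq z <- rs | P z] -> abs (y - a) <= s by rewrite mem_filter => /andP[].
case: [seq z <- rs | P z] fP => [|y1 [|y2 t]]// fP _ Eprod.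
exists y1, y2, (lead_coef (f - c *: g) *: (\prod_(z <- t) ('X - z%:P) * \prod_(z <- [seq z <- rs | ~~ P z]) ('X - z%:P))).
split; [by apply: fP; rewrite mem_head|by apply: fP; rewrite !inE eqxx orbT|].
by rewrite {1}Ep Eprod !big_cons -!mul_polyC; ring.
Qed.

(** For generic [c], no zero of [f - c g] is in the given open discs of radius [s]
    centered in [W], so those of the closed disc are close to [Q]. *)
Lemma near_two_preimages (V : set (berkP1 abs)) : nbhs Q V -> exists c y1 y2 q,
  [/\ c != 0, V (classical_pt abs (Some y1)), V (classical_pt abs (Some y2)) &
      f - c *: g = ('X - y1%:P) * (('X - y2%:P) * q)].
Proof.
move=> /(nbhs_disc_generic s0')[W hW].
have l0 : l != 0 by rewrite -(absv_gt0 abs) ls.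
(* c stays at distance s from the values phi(w), and also from 0 *)
pose T := [seq (u - a) / l | u <- 0 :: [seq f.[w] / g.[w] | w <- W]].
have [t t1 tT] := avoid_discs abs T.
pose c := a + l * t.
have ca : abs (c - a) <= s by rewrite /c addrAC subrr add0r absvM ls ler_piMr.
have cu u : u \in 0 :: [seq f.[w] / g.[w] | w <- W] -> s <= abs (c - u).
  move=> uT; have /tT h : (u - a) / l \in T by apply/mapP; exists u.
  have -> : c - u = l * (t - (u - a) / l) by rewrite /c; field.
  by rewrite absvM ls ler_peMr.
have c0 : c != 0.
  rewrite -(absv_gt0 abs) (lt_le_trans s0)//.
  by rewrite -[X in abs X]subr0; apply: cu; rewrite mem_head.
have [y1 [y2 [q [y1a y2a Eq]]]] := two_preimages ca.
have p0 : f - c *: g != 0.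
  apply/eqP => p0; have := anorm_num_sub_den c; rewrite p0 -[X in anorm _ X]/(0%:P) anormC// absv0.
  by move=> /eqP; rewrite eq_sym gt_eqF// mulr_gt0// lt_max s0 orbT.
have far y w : abs (y - a) <= s -> root (f - c *: g) y -> w \in W -> s <= abs (w - y).
  move=> ya ry wW; rewrite leNgt; apply/negP => wy.
  have wa : abs (w - a) <= s.
    have -> : w - a = (w - y) + (y - a) by ring.
    by rewrite (le_trans (absvD _ _ _))// ge_max ltW.
  have yw : abs (y - w) < s by rewrite absvB.
  have := horner_lt_disc p0 ry yw.
  rewrite (@disc_pt_center _ _ _ w a)// anorm_num_sub_den max_r//.
  apply/negP; rewrite -leNgt.
  (* f - c g has maximal absolute value at w: by the genericity of c if w is not
     close to a pole, and since N dominates otherwise *)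
  have [gB|gB] := ltP (abs g.[w]) B.
    have lt : abs (('X - c%:P).[w] * g.[w]) < abs N.[w].
      rewrite Nx// absvM hornerXsubC; apply: (@le_lt_trans _ _ (s * abs g.[w])); last by rewrite ltr_pM2l.
      apply: ler_wpM2r; first exact: absv_ge0.
      have -> : w - c = (w - a) + (a - c) by rewrite addrA subrK.
      by rewrite (le_trans (absvD _ _ _))// ge_max wa absvB.
    by rewrite combE hornerD hornerM (absv_isosceles lt) Nx.
  have gw0 : g.[w] != 0 by rewrite -(absv_gt0 abs) (lt_le_trans B0).
  have -> : (f - c *: g).[w] = (f.[w] / g.[w] - c) * g.[w].
    by rewrite !hornerE; field.
  rewrite absvM; apply: ler_pM => //; first exact: ltW.
  by rewrite absvB; apply: cu; rewrite inE; apply/orP; right; apply/mapP; exists w.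
exists c, y1, y2, q; split=> //.
- by apply: hW => // w; apply: far => //; rewrite Eq rootM root_XsubC eqxx.
- by apply: hW => // w; apply: far => //; rewrite Eq !rootM !root_XsubC eqxx orbT.
Qed.

End RepellingPoint.
End Core.

(** * Components not containing infinity *)

Section CoreComponent.
Variables (R : realType) (K : closedFieldType) (abs : nonarchAbs R K) (phi : ratFun K).

Local Notation f := (ratNum phi).
Local Notation g := (ratDen phi).
Local Notation e := (ratFun_deg phi).

(** The theorem when infinity is outside the component. The condition near [Q] is a
    concrete form of the inequality [2 <= local_degree phi Q]; the clause [c != 0]
    keeps [c] finite after the change of coordinate below. *)
Lemma component_fixed_disc (P x0 : berkP1 abs)
    (U := path_component R (~` [set P]) x0) :
  ~ U (classical_pt abs None) ->
  (forall y, exists2 x, U x & ratFun_map phi x = y) ->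
  (forall w, U (classical_pt abs (Some w)) -> ~ root (f - 'X * g) w) ->
  exists Q, [/\ U Q, hyperbolic Q, ratFun_map phi Q = Q &
    forall V, nbhs Q V -> exists c y1 y2 q,
      [/\ c != 0, V (classical_pt abs (Some y1)), V (classical_pt abs (Some y2)) &
        f - c *: g = ('X - y1%:P) * (('X - y2%:P) * q)]].
Proof.
move=> Uinf surj nofix; set N := f - 'X * g in nofix *.
have g0 := ratDen_neq0 phi.
have kill (x : berkP1 abs) (p : {poly K}) : p != 0 -> (size p <= e.+1)%N -> U x -> x e p = 0 ->
    exists2 w, p.[w] = 0 & U (classical_pt abs (Some w)).
  by move=> p0 sp Ux /(classicalP p0 sp) [[w|] [xE pw]]; [exists w; rewrite // -xE|rewrite xE in Ux].
have [a ga Ua] : exists2 a, g.[a] = 0 & U (classical_pt abs (Some a)).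
  have [x Ux xinf] := surj (classical_pt abs None).
  apply: (kill x) => //; first exact: size_den.
  have := ratFun_map_Y phi x; rewrite xinf classical_inf1 => /esym/eqP.
  by rewrite mulf_eq0 invr_eq0 (gt_eqF (ratFun_max_gt0 phi x)) orbF => /eqP.
have fa := num_den_root ga.
have [x fx Ux] : exists2 x, (f - a *: g).[x] = 0 & U (classical_pt abs (Some x)).
  have [x Ux xa] := surj (classical_pt abs (Some a)).
  apply: (kill x) => //; last 2 first.
  - exact: size_num_sub_den.
  - have := ratFun_map_XsubC phi x a; rewrite xa.
    rewrite classical_root_eq0 ?hornerXsubC ?subrr// => /esym/eqP.
    by rewrite mulf_eq0 invr_eq0 (gt_eqF (ratFun_max_gt0 phi x)) orbF => /eqP.
  apply: contraNneq fa => h; have := congr1 (fun p => p.[a]) h.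
  by rewrite !hornerE ga mulr0 oppr0 addr0 => ->.
have [tau tau01 Ptau] := join_between Ua Uinf; have /andP[tau0 tau1] := tau01.
have xdisc := component_in_disc Ua tau01 Ptau Ux.
have Nr w : root N w -> tau <= abs (w - a) * (1 - tau).
  move=> rw; rewrite leNgt; apply/negP => lt.
  exact: nofix (classical_in_component Ua tau01 Ptau lt) rw.
have Na : N.[a] = f.[a] by rewrite !hornerE ga mulr0 oppr0 addr0.
have Na0 : 0 < abs N.[a] by rewrite absv_gt0 Na.
(* if P is not infinity, s1 is the radius r of P: as a = phi(x) for some x in the
   open disc, N(x) = (a - x) g(x) *)
have [s1 [s10 s1tau Hs1]] : exists s1, [/\ 0 <= s1, s1 * (1 - tau) <= tau &
    abs N.[a] < s1 * anorm (disc_pt abs a s1) g].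
  have [t1|t1] := eqVneq tau 1.
    have [s1 s10 h] := @radius_large R K abs a g (abs N.[a]) g0.
    by exists s1; split=> //; rewrite t1 subrr mulr0 ler01.
  have t1' : 0 < 1 - tau by rewrite subr_gt0 lt_neqAle t1.
  set r := tau / (1 - tau).
  have r0 : 0 < r by rewrite divr_gt0.
  have rtau : r * (1 - tau) = tau by rewrite divfK// gt_eqF.
  have xr : abs (x - a) < r by rewrite ltr_pdivlMr.
  exists r; split; rewrite ?(ltW r0) ?rtau//.
  have NE : N.[x] = (a - x) * g.[x].
    rewrite /N; move: fx; rewrite !hornerE => /eqP; rewrite subr_eq0 => /eqP ->.
    by ring.
  have Nxa : abs N.[x] = abs N.[a].
    rewrite (@horner_eq_disc _ _ _ x (abs (x - a))) ?absv_ge0//; last first.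
      move=> w /Nr; rewrite -ler_pdivrMr// => rw.
      have -> : w - x = (a - x) + (w - a) by ring.
      have lt : abs (a - x) < abs (w - a) by rewrite absvB (lt_le_trans xr).
      by rewrite (absv_isosceles lt) absvB ltW// absvB.
    rewrite (@disc_pt_center _ _ _ x a) ?lexx//; symmetry.
    apply: horner_eq_disc; first exact: absv_ge0.
    by move=> w /Nr; rewrite -ler_pdivrMr// => rw; rewrite ltW// (lt_le_trans xr).
  have gx : g.[x] != 0.
    by apply: contraTneq Na0 => gx; rewrite -Nxa NE gx mulr0 absv0 ltxx.
  rewrite -Nxa NE absvM absvB; apply: (@lt_le_trans _ _ (r * abs g.[x])).
    by rewrite ltr_pM2r// absv_gt0.
  apply: ler_wpM2l; first exact: ltW.
  rewrite (@disc_pt_center _ _ _ a x); last by rewrite absvB ltW.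
  by apply: horner_le_disc; exact: ltW.
have [s [s0 ss1 sN]] := radius_exists Na0 s10 Hs1.
have stau : s * (1 - tau) < tau.
  have [t1|t1] := eqVneq tau 1; first by rewrite t1 subrr mulr0 ltr01.
  have t1' : 0 < 1 - tau by rewrite subr_gt0 lt_neqAle t1.
  by apply: lt_le_trans s1tau; rewrite ltr_pM2r.
have [l ls] := radius_value s0 g0 sN.
have Nroot w : root N w -> s < abs (w - a).
  move=> /Nr h; rewrite ltNge; apply/negP => le.
  have := lt_le_trans stau h; apply/negP; rewrite -leNgt.
  by apply: ler_wpM2r => //; rewrite subr_ge0.
exists (disc_pt abs a s); split.
- exact: (disc_pt_in_component Ua tau01 Ptau (ltW s0) stau).
- exact: disc_pt_hyperbolic.
- exact: disc_pt_fixed.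
- by move=> V; apply: (near_two_preimages s0 ls ga Nroot sN).
Qed.

Lemma num_sub_den_neq0 c : (2 <= e)%N -> f - c *: g != 0.
Proof.
move=> e2; apply/eqP => /eqP; rewrite subr_eq0 => /eqP fE.
have sg : size g = 1%N.
  have := ratFun_coprime phi; rewrite fE -mul_polyC coprimep_sym coprimepMr coprimepp.
  by move=> /andP[_ /eqP].
have : (e <= 0)%N.
  rewrite /ratFun_deg sg -subn1 leq_subLR geq_max leqnn andbT fE.
  by rewrite (leq_trans (size_scale_leq _ _))// sg.
by rewrite leqNgt (leq_trans _ e2).
Qed.

(** The number of solutions of [phi = c] in [V] is at least 2 if [f - c g] has two zeros
    in [V], distinct or not. *)
Lemma preim_count_ge2 (V : set (berkP1 abs)) c y1 y2 q : (2 <= e)%N ->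
  V (classical_pt abs (Some y1)) -> V (classical_pt abs (Some y2)) ->
  f - c *: g = ('X - y1%:P) * (('X - y2%:P) * q) -> (2 <= preim_count phi V (Some c))%N.
Proof.
move=> e2 V1 V2 Eh; have h0 := num_sub_den_neq0 c e2.
have [rs Er] := poly_split (f - c *: g).
have rsP y : root (f - c *: g) y = (y \in rs).
  by rewrite {1}Er rootZ ?lead_coef_eq0// root_prod_XsubC.
pose r := [seq i <- undup (None :: map Some rs) | `[< V (classical_pt abs i) >]].
have ry y : V (classical_pt abs (Some y)) -> root (f - c *: g) y -> Some y \in r.
  move=> Vy; rewrite rsP => yr; rewrite mem_filter mem_undup inE map_f// orbT andbT.
  exact/asboolP.
have r1 : Some y1 \in r by apply: ry => //; rewrite Eh rootM root_XsubC eqxx.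
have r2 : Some y2 \in r by apply: ry => //; rewrite Eh !rootM !root_XsubC eqxx orbT.
have ur : uniq r by rewrite filter_uniq// undup_uniq.
rewrite /preim_count (fsbigE r)//; last 2 first.
- by move=> i /=; rewrite mem_filter => /andP[/asboolP].
- move=> [y|] Vy; rewrite mem_filter mem_undup inE.
    rewrite [`[< _ >]]asboolT//= mem_map => [yr|? ? [->]//].
    by apply: mupNroot; rewrite rsP.
  by rewrite asboolT.
rewrite -big_filter (_ : [seq i <- r | _] = r); last first.
  by apply/all_filterP/allP => i; rewrite mem_filter => /andP[/asboolP Vi _]; rewrite inE.
rewrite (big_rem _ r1)/=.
have m1 y : root (f - c *: g) y -> (0 < mup y (f - c *: g))%N.
  by rewrite -XsubC_dvd// dvdp_XsubCl.
have [E|ne] := eqVneq y1 y2.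
  rewrite (leq_trans _ (leq_addr _ _))// mup_geq// Eh -E mulrA -expr2.
  exact: dvdp_mulr.
have r2' : Some y2 \in rem (Some y1) r.
  rewrite mem_rem_uniq// inE r2 andbT; apply: contraNneq ne => -[->].
  by [].
rewrite (big_rem _ r2')/=.
have M1 : (0 < mup y1 (f - c *: g))%N by apply: m1; rewrite Eh rootM root_XsubC eqxx.
have M2 : (0 < mup y2 (f - c *: g))%N by apply: m1; rewrite Eh !rootM !root_XsubC eqxx orbT.
by rewrite addnA (leq_trans _ (leq_addr _ _))// -[2%N]/(1 + 1)%N leq_add.
Qed.

Lemma local_degree_ge2 (Q : berkP1 abs) : (2 <= e)%N ->
  (forall V, nbhs Q V -> exists c y1 y2 q,
      [/\ V (classical_pt abs (Some y1)), V (classical_pt abs (Some y2)) &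
        f - c *: g = ('X - y1%:P) * (('X - y2%:P) * q)]) -> (2 <= local_degree phi Q)%N.
Proof.
move=> e2 h; have lt : (2 < e.+1)%N by [].
rewrite /local_degree.
apply: (@leq_bigmax_cond _ _ (fun k : 'I_e.+1 => k : nat) (Ordinal lt)).
apply/asboolP => V /h [c [y1 [y2 [q [V1 V2 E]]]]].
by exists (Some c); exact: (preim_count_ge2 e2 V1 V2 E).
Qed.

End CoreComponent.

(** * Change of coordinate *)

Section FormCompTheory.
Variables (K : fieldType).
Implicit Types (u v f g p : {poly K}).

Lemma form_comp_exp u v d p i : (size p <= d.+1)%N ->
  form_comp u v (i * d) (p ^+ i) = form_comp u v d p ^+ i.
Proof.
move=> sp; elim: i => [|i IHi].
  by rewrite mul0n !expr0 (@form_compXn _ u v 0 0)// expr0 mul1r.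
have spi : (size (p ^+ i)%R <= (i * d).+1)%N.
  rewrite (leq_trans (size_poly_exp_leq _ _))// ltnS mulnC leq_mul2l.
  by case: (size p) sp => [|k] /=; rewrite ?orbT// ltnS => ->; rewrite orbT.
by rewrite mulSn exprS form_compM// IHi exprS.
Qed.

(** Substitution of forms is associative. *)
Lemma form_comp_comp u v e f g d p : (size f <= e.+1)%N -> (size g <= e.+1)%N ->
  form_comp u v (d * e) (form_comp f g d p) =
  form_comp (form_comp u v e f) (form_comp u v e g) d p.
Proof.
move=> sf sg.
have sX (h : {poly K}) i : (size h <= e.+1)%N -> (size (h ^+ i)%R <= (i * e).+1)%N.
  move=> sh; rewrite (leq_trans (size_poly_exp_leq _ _))// ltnS mulnC leq_mul2l.
  by case: (size h) sh => [|k] /=; rewrite ?orbT// ltnS => ->; rewrite orbT.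
rewrite [form_comp f g d p]/form_comp form_comp_sum [RHS]/form_comp; apply: eq_bigr => i _.
have id : (i <= d)%N by rewrite -ltnS.
have -> : (d * e = i * e + (d - i) * e)%N by rewrite -mulnDl subnKC.
rewrite form_compZ form_compM ?sX//.
by rewrite !form_comp_exp.
Qed.

Lemma form_comp_id d p : (size p <= d.+1)%N -> form_comp 'X 1 d p = p.
Proof.
move=> sp; rewrite /form_comp.
under eq_bigr do rewrite expr1n mulr1.
rewrite -poly_def; apply/polyP => i; rewrite coef_poly; case: ltnP => // di.
by rewrite nth_default// (leq_trans sp).
Qed.

Lemma horner_form_comp u v d p x : (size p <= d.+1)%N -> v.[x] != 0 ->
  (form_comp u v d p).[x] = v.[x] ^+ d * p.[u.[x] / v.[x]].
Proof.
move=> sp vx; rewrite /form_comp horner_sum (horner_coef_wide _ sp) mulr_sumr.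
apply: eq_bigr => i _; have id : (i <= d)%N by rewrite -ltnS.
have -> : v.[x] ^+ d = v.[x] ^+ i * v.[x] ^+ (d - i) by rewrite -exprD subnKC.
rewrite !hornerE expr_div_n /=; field.
by rewrite expf_neq0.
Qed.

Lemma horner_form_comp0 u v d p x : v.[x] = 0 ->
  (form_comp u v d p).[x] = p`_d * u.[x] ^+ d.
Proof.
move=> vx; rewrite /form_comp horner_sum big_ord_recr /= big1 => [|i _].
  by rewrite add0r !hornerE subnn expr0 /= mulr1.
rewrite !hornerE vx expr0n subn_eq0 leqNgt ltn_ord/=.
by rewrite /= ?mulr0 ?mulr1.
Qed.

End FormCompTheory.

Section RatFunMapTheory.
Variables (R : realType) (K : closedFieldType) (abs : nonarchAbs R K).
Implicit Types (phi psi chi : ratFun K) (x : berkP1 abs).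

Lemma ratFun_map_comp phi psi chi x :
  ratFun_deg chi = (ratFun_deg phi * ratFun_deg psi)%N ->
  ratNum chi = form_comp (ratNum psi) (ratDen psi) (ratFun_deg phi) (ratNum phi) ->
  ratDen chi = form_comp (ratNum psi) (ratDen psi) (ratFun_deg phi) (ratDen phi) ->
  ratFun_map phi (ratFun_map psi x) = ratFun_map chi x.
Proof.
move=> dE nE rE.
have m0 := ratFun_max_gt0 psi x.
have mE : ratFun_max phi (ratFun_map psi x) =
    ratFun_max chi x / ratFun_max psi x ^+ ratFun_deg phi.
  rewrite {1}/ratFun_max !ratFun_mapE ?size_num ?size_den// -nE -rE -dE.
  by rewrite maxr_pMl ?invr_ge0 ?exprn_ge0 ?(ltW m0).
apply: berkP1_eq => d p sp; rewrite !ratFun_mapE//; last first.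
  by apply: size_form_comp; [exact: size_num|exact: size_den].
rewrite form_comp_comp ?size_num ?size_den// -nE -rE mE dE -mulnA.
rewrite expr_div_n -exprM [(ratFun_deg phi * d)%N]mulnC; field.
by rewrite !expf_neq0 ?gt_eqF// ratFun_max_gt0.
Qed.

Lemma ratFun_map_id phi x : ratNum phi = 'X -> ratDen phi = 1 -> ratFun_map phi x = x.
Proof.
move=> nE rE; have dE : ratFun_deg phi = 1%N.
  by rewrite /ratFun_deg nE rE size_polyX size_poly1.
apply: berkP1_eq => d p sp; rewrite ratFun_mapE// dE muln1 nE rE form_comp_id//.
by rewrite /ratFun_max dE nE rE hnorm_normal expr1n divr1.
Qed.

Lemma ratFun_map_continuous phi : continuous (@ratFun_map R K abs phi).
Proof.
have mc : continuous (@ratFun_max R K abs phi).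
  by apply: max_fun_continuous; exact: hnorm_continuous.
apply: berk_continuousP => d p; have [sp|sp] := leqP (size p) d.+1; last first.
  have -> : (fun x : berkP1 abs => ratFun_map phi x d p) = fun=> 0.
    by apply/funext => x; rewrite hnorm_out.
  by apply: (@cst_continuous (berkP1 abs) R 0).
have -> : (fun x : berkP1 abs => ratFun_map phi x d p) = fun x => x (d * ratFun_deg phi)%N
    (form_comp (ratNum phi) (ratDen phi) d p) / ratFun_max phi x ^+ d.
  by apply/funext => x; rewrite ratFun_mapE.
have hc := @hnorm_continuous R K abs (d * ratFun_deg phi)%N (form_comp (ratNum phi) (ratDen phi) d p).
move=> x; apply: (cvgM (hc x)); apply: cvgV.
  by rewrite expf_neq0// gt_eqF// ratFun_max_gt0.
apply: (@continuous_comp _ _ _ (@ratFun_max R K abs phi) (fun y : R => y ^+ d)); first exact: mc.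
by apply: exprn_continuous.
Qed.

Lemma ratFun_map_classical_fixed phi w : root (ratNum phi - 'X * ratDen phi) w ->
  ratFun_map phi (classical_pt abs (Some w)) = classical_pt abs (Some w).
Proof.
move=> /eqP rw; apply: classical_finP; rewrite ratFun_map_XsubC.
by rewrite classical_root_eq0 ?mul0r// -[RHS]rw !hornerE.
Qed.

End RatFunMapTheory.

Section Conjugation.
Variables (R : realType) (K : closedFieldType) (abs : nonarchAbs R K).
Variables (phi : ratFun K) (b : K).

Local Notation f := (ratNum phi).
Local Notation g := (ratDen phi).
Local Notation e := (ratFun_deg phi).

Lemma inv_at_den_neq0 : ('X - b%:P) != 0 :> {poly K}.
Proof. by rewrite polyXsubC_eq0. Qed.

Lemma inv_at_coprime : coprimep 1 ('X - b%:P).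
Proof. exact: coprime1p. Qed.

(** The coordinate [1 / (z - b)], sending [b] to infinity. *)
Definition inv_at : ratFun K := RatFun inv_at_den_neq0 inv_at_coprime.

Lemma inv_at_inv_den_neq0 : 'X != 0 :> {poly K}.
Proof. by rewrite polyX_eq0. Qed.

Lemma inv_at_inv_coprime : coprimep (b *: 'X + 1) 'X.
Proof. by rewrite coprimepX rootE !hornerE oner_eq0. Qed.

(** Its inverse, [b + 1 / z]. *)
Definition inv_at_inv : ratFun K := RatFun inv_at_inv_den_neq0 inv_at_inv_coprime.

Lemma inv_at_deg : ratFun_deg inv_at = 1%N.
Proof. by rewrite /ratFun_deg/= size_poly1 size_XsubC. Qed.

Lemma size_inv_at_inv_num : (size (b *: 'X + 1)%R <= 2)%N.
Proof.
rewrite (leq_trans (size_polyD _ _))// geq_max size_poly1 andbT.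
by rewrite (leq_trans (size_scale_leq _ _))// size_polyX.
Qed.

Lemma inv_at_inv_deg : ratFun_deg inv_at_inv = 1%N.
Proof. by rewrite /ratFun_deg/= size_polyX (maxn_idPr size_inv_at_inv_num). Qed.

Lemma X_den_neq0 : 1 != 0 :> {poly K}.
Proof. exact: oner_neq0. Qed.

Lemma X_coprime : coprimep 'X (1 : {poly K}).
Proof. exact: coprimep1. Qed.

Lemma inv_atK (x : berkP1 abs) : ratFun_map inv_at_inv (ratFun_map inv_at x) = x.
Proof.
rewrite (@ratFun_map_comp _ _ _ _ _ (RatFun X_den_neq0 X_coprime)) ?ratFun_map_id//.
- by rewrite inv_at_deg inv_at_inv_deg /ratFun_deg/= size_polyX size_poly1.
- rewrite inv_at_inv_deg /= form_compD form_compZ form_comp_X form_comp_Y.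
  by rewrite alg_polyC addrC subrK.
- by rewrite inv_at_inv_deg /= form_comp_X.
Qed.

Lemma inv_at_invK (x : berkP1 abs) : ratFun_map inv_at (ratFun_map inv_at_inv x) = x.
Proof.
rewrite (@ratFun_map_comp _ _ _ _ _ (RatFun X_den_neq0 X_coprime)) ?ratFun_map_id//.
- by rewrite inv_at_deg inv_at_inv_deg /ratFun_deg/= size_polyX size_poly1.
- by rewrite inv_at_deg /= form_comp_Y.
- by rewrite inv_at_deg /= form_comp_XsubC addrC addKr.
Qed.

Hypothesis e2 : (2 <= e)%N.

Local Notation h := (f - b *: g).

Lemma inv_comp_coprime : coprimep g h.
Proof. by rewrite -mul_polyC addrC -mulNr coprimep_addl_mul coprimep_sym ratFun_coprime. Qed.

(** The composite of [phi] with [inv_at b]. *)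
Definition inv_comp : ratFun K := RatFun (num_sub_den_neq0 b e2) inv_comp_coprime.

Lemma inv_comp_deg : ratFun_deg inv_comp = e.
Proof.
rewrite {1}/ratFun_deg /=; congr _.-1; apply/eqP; rewrite eqn_leq !geq_max leq_maxr/=.
rewrite leq_maxl !andbT; apply/andP; split.
  rewrite (leq_trans (size_polyD _ _))// size_polyN geq_max leq_maxl/=.
  by rewrite (leq_trans (size_scale_leq _ _))// leq_maxr.
have -> : size f = size (h + b *: g)%R by rewrite subrK.
rewrite (leq_trans (size_polyD _ _))//.
rewrite geq_max leq_maxr/=.
by rewrite (leq_trans (size_scale_leq _ _))// leq_maxl.
Qed.

Lemma inv_compE (x : berkP1 abs) :
  ratFun_map inv_at (ratFun_map phi x) = ratFun_map inv_comp x.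
Proof.
apply: ratFun_map_comp; rewrite inv_at_deg; first by rewrite mul1n inv_comp_deg.
  by rewrite /= form_comp_Y.
by rewrite /= form_comp_XsubC.
Qed.

Local Notation cj := (form_comp (b *: 'X + 1) 'X e).
Local Notation cjV := (form_comp 1 ('X - b%:P) e).

(** On forms of degree [e], the substitution [cjV] given by [inv_at b] undoes the
    substitution [cj] given by [inv_at_inv b]. *)
Lemma cjK (p : {poly K}) : (size p <= e.+1)%N -> cjV (cj p) = p.
Proof.
move=> sp; have := @form_comp_comp K 1 ('X - b%:P) 1 (b *: 'X + 1) 'X e p size_inv_at_inv_num.
rewrite size_polyX => /(_ isT); rewrite muln1 => ->.
rewrite form_compD form_compZ form_comp_X form_comp_Y alg_polyC addrC subrK.
by rewrite form_comp_id.
Qed.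

Lemma size_cj (p : {poly K}) : (size (cj p) <= e.+1)%N.
Proof. by rewrite -[e in X in (_ <= X)%N]muln1 size_form_comp ?size_inv_at_inv_num ?size_polyX. Qed.

Let size_g : (size g <= e.+1)%N := size_den phi.
Let size_h : (size h <= e.+1)%N := size_num_sub_den phi b.

Lemma inv_conj_den_neq0 : cj h != 0.
Proof.
apply/eqP => h0; have := num_sub_den_neq0 b e2; rewrite -(cjK size_h) h0.
by rewrite /form_comp big1 ?eqxx// => i _; rewrite coef0 scale0r.
Qed.

Lemma inv_conj_coprime : coprimep (cj g) (cj h).
Proof.
apply/Pdiv.ClosedField.coprimepP => z; rewrite rootE => /eqP gz; apply/eqP => hz.
have [z0|z0] := eqVneq z 0.
  have vz : ('X : {poly K}).[z] = 0 by rewrite hornerX.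
  move: gz hz; rewrite !horner_form_comp0// z0 !hornerE /= ?mulr0 ?add0r ?expr1n ?mulr1 => ge he.
  have : (maxn (size g) (size h)).-1 = e by exact: inv_comp_deg.
  have := num_sub_den_neq0 b e2; have := ratDen_neq0 phi.
  rewrite -!lead_coef_eq0 /lead_coef.
  case: leqP => _ g1 h1 E; [move: h1|move: g1]; rewrite E ?he ?ge ?eqxx//.
have vz : ('X : {poly K}).[z] != 0 by rewrite hornerX.
move: gz hz; rewrite !horner_form_comp// => /eqP.
rewrite mulf_eq0 expf_eq0 (negPf vz) andbF /= => gz /eqP.
rewrite mulf_eq0 expf_eq0 (negPf vz) andbF /=; apply/negP.
exact: coprimep_root inv_comp_coprime gz.
Qed.

(** The conjugate of [phi] by [inv_at b]. *)
Definition inv_conj : ratFun K := RatFun inv_conj_den_neq0 inv_conj_coprime.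

Hypothesis fixb : root (f - 'X * g) b.

Let hb : h.[b] = 0.
Proof. by rewrite -[RHS](eqP fixb) !hornerE. Qed.

Lemma inv_conj_deg : ratFun_deg inv_conj = e.
Proof.
(* the coefficient of degree e of the new numerator is g(b) *)
have gb : g.[b] != 0.
  by apply: contraTneq (oner_neq0 K) => gb; have := coprimep_root inv_comp_coprime (introT eqP gb); rewrite hb eqxx.
have : (cj g)`_e != 0.
  apply: contraNneq gb => g0; rewrite -(cjK size_g) horner_form_comp0.
    by rewrite g0 mul0r.
  by rewrite hornerXsubC subrr.
move=> ce; have sg : (e < size (cj g))%N.
  by rewrite ltnNge; apply: contraNN ce => /(nth_default 0) ->.
rewrite /ratFun_deg/=; have -> : maxn (size (cj g)) (size (cj h)) = e.+1; last by [].
apply/eqP; rewrite eqn_leq geq_max !size_cj/=.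
by rewrite (leq_trans sg)// leq_maxl.
Qed.

Lemma inv_conjE (x : berkP1 abs) :
  ratFun_map inv_conj (ratFun_map inv_at x) = ratFun_map inv_at (ratFun_map phi x).
Proof.
rewrite inv_compE; apply: ratFun_map_comp; rewrite inv_conj_deg ?inv_at_deg.
- by rewrite muln1 inv_comp_deg.
- by rewrite /= cjK.
- by rewrite /= cjK.
Qed.

End Conjugation.

(** * The general case *)

Section Transfer.
Variables (R : realType) (K : closedFieldType) (abs : nonarchAbs R K) (phi : ratFun K).

Local Notation f := (ratNum phi).
Local Notation g := (ratDen phi).
Local Notation e := (ratFun_deg phi).

Lemma inv_at_inv_classical (b w : K) : w != 0 ->
  ratFun_map (inv_at_inv b) (classical_pt abs (Some w)) = classical_pt abs (Some (b + w^-1)).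
Proof.
move=> w0; apply: classical_finP; rewrite ratFun_map_XsubC.
by rewrite classical_root_eq0 ?mul0r// !hornerE /=; field.
Qed.

Lemma inv_at_inv_classical0 (b : K) :
  ratFun_map (inv_at_inv b) (classical_pt abs (Some 0)) = classical_pt abs None.
Proof.
apply: classical_infP; rewrite ratFun_map_Y.
by rewrite classical_root_eq0 ?mul0r//= hornerX.
Qed.

Lemma inv_at_inv_inf (b : K) :
  ratFun_map (inv_at_inv b) (classical_pt abs None) = classical_pt abs (Some b).
Proof.
apply: classical_finP; rewrite ratFun_map_XsubC.
rewrite hnorm_inf ?classical_inf1 ?size_num_sub_den// inv_at_inv_deg/=.
rewrite addrC addKr coef1/= absv0 mul0r//.
Qed.

(** The theorem when some finite fixed point [b] is outside the component: conjugate
    by [inv_at b] and transport the conclusion of [component_fixed_disc] back. *)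
Lemma component_fixed_conj (b : K) (P x0 : berkP1 abs)
    (U := path_component R (~` [set P]) x0) : (2 <= e)%N ->
  root (f - 'X * g) b -> ~ U (classical_pt abs (Some b)) ->
  (forall y, exists2 x, U x & ratFun_map phi x = y) ->
  (forall a, U (classical_pt abs a) ->
     ratFun_map phi (classical_pt abs a) <> classical_pt abs a) ->
  exists Q, U Q /\ repelling_fixed phi Q.
Proof.
move=> e2 rb Ub surj nofix.
pose M := @ratFun_map R K abs (inv_at b).
pose M' := @ratFun_map R K abs (inv_at_inv b).
have MK : cancel M M' by exact: inv_atK.
have M'K : cancel M' M by exact: inv_at_invK.
pose psi := inv_conj b e2.
have psiM x : ratFun_map psi (M x) = M (ratFun_map phi x) by exact: inv_conjE.
pose U' := path_component R (~` [set M P]) (M x0).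
have UM x : U x -> U' (M x).
  apply: path_component_homo; first exact: ratFun_map_continuous.
  by move=> z /(can_inj MK).
have UM' x : U' x -> U (M' x).
  move=> U'x; rewrite /U -(MK P) -(MK x0).
  apply: path_component_homo U'x; first exact: ratFun_map_continuous.
  by move=> z /(can_inj M'K).
have psi_fix x : ratFun_map psi x = x -> ratFun_map phi (M' x) = M' x.
  by move=> px; apply: (can_inj MK); rewrite -psiM M'K.
have M'cl w : exists a, M' (classical_pt abs (Some w)) = classical_pt abs a.
  have [->|w0] := eqVneq w 0; first by exists None; exact: inv_at_inv_classical0.
  by exists (Some (b + w^-1)); exact: inv_at_inv_classical.
have [] := @component_fixed_disc R K abs psi (M P) (M x0).
- by move=> /UM'; rewrite /M' inv_at_inv_inf.
- move=> y; have [x Ux xy] := surj (M' y).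
  by exists (M x); [exact: UM|rewrite psiM xy M'K].
- move=> w /UM' Uw /(ratFun_map_classical_fixed abs) /psi_fix.
  by have [a Ea] := M'cl w; move: Uw; rewrite Ea => /nofix.
move=> Q' [UQ' hypQ' fixQ' nbhsQ'].
exists (M' Q'); split; first exact: UM'.
split; last 2 first.
- exact: psi_fix.
- apply: local_degree_ge2 => // V nV.
  have nV' : nbhs Q' ((M' @^-1` V) `&` [set x : berkP1 abs | x 1%N 'X != 0 * x 1%N 1]).
    apply: filterI; first exact: ratFun_map_continuous.
    apply: open_nbhs_nbhs; split; first exact: open_hnorm_neq.
    rewrite /= mul0r; apply/eqP => Q0; apply: hypQ'; exists (Some 0) => //.
    by symmetry; apply: classical_finP; rewrite subr0.
  have [c [y1 [y2 [q [c0 [V1 n1] [V2 n2] E]]]]] := nbhsQ' _ nV'.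
  have nz (y : K) : (classical_pt abs (Some y) 1%N 'X != 0 * classical_pt abs (Some y) 1%N 1) -> y != 0.
    rewrite mul0r /= /classical_fun size_polyX/= hornerX.
    by apply: contraNneq => ->; rewrite absv0 mul0r.
  have z1 := nz _ n1; have z2 := nz _ n2.
  have cjE (p : {poly K}) : (size p <= e.+1)%N -> form_comp 1 ('X - b%:P) e (form_comp (b *: 'X + 1) 'X e p) = p.
    exact: cjK.
  have lin y : y != 0 -> form_comp 1 ('X - b%:P) 1 ('X - y%:P) = (- y) *: ('X - (b + y^-1)%:P).
    move=> y0; rewrite form_comp_XsubC -!mul_polyC polyCN polyCD.
    have : y%:P * (y^-1)%:P = 1 :> {poly K} by rewrite -polyCM divff.
    by move: (y%:P) ((y^-1)%:P) => u v uv; rewrite -uv; ring.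
  have sq : (size q <= (e - 2).+1)%N.
    have [->|q0] := eqVneq q 0; first by rewrite size_poly0.
    have := size_num_sub_den psi c; rewrite E !size_monicM ?monicXsubC// ?mulf_neq0 ?polyXsubC_eq0//.
    rewrite !size_XsubC inv_conj_deg// !addSn !add0n/=.
    by move=> h; rewrite -(leq_add2l 2) addnS subnKC.
  have sq2 : (size (('X - y2%:P) * q)%R <= (1 + (e - 2)).+1)%N.
    rewrite (leq_trans (size_polyMleq _ _))// size_XsubC /= add1n addSn add0n; exact: sq.
  have := congr1 (form_comp 1 ('X - b%:P) e) E.
  rewrite form_compD -scaleNr form_compZ !cjE ?size_den ?size_num_sub_den//.
  have eE : e = (1 + (1 + (e - 2)))%N by rewrite addnA subnKC.
  have -> r : form_comp 1 ('X - b%:P) e r = form_comp 1 ('X - b%:P) (1 + (1 + (e - 2))) r.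
    by rewrite -eE.
  rewrite form_compM ?size_XsubC// form_compM ?size_XsubC// !lin//.
  set q' := form_comp _ _ _ q => E'.
  (* in the original coordinate, c and the y_i become b + 1/c and b + 1/y_i *)
  exists (b + c^-1), (b + y1^-1), (b + y2^-1), ((- c^-1 * y1 * y2) *: q').
  split; [by rewrite -inv_at_inv_classical|by rewrite -inv_at_inv_classical|].
  have -> : f - (b + c^-1) *: g = (- c^-1) *: (g - c *: (f - b *: g)).
    rewrite -!mul_polyC.
    have : c%:P * (c^-1)%:P = 1 :> {poly K} by rewrite -polyCM divff.
    rewrite polyCD polyCN; move: (c%:P) ((c^-1)%:P) => u v uv.
    transitivity (u * v * f - (u * v * b%:P + v) * g); first by rewrite uv; ring.
    by ring.
  rewrite -scaleNr E' -!mul_polyC !polyCM !polyCN; ring.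
- move=> [[w|] _ Ew].
    have [a Ea] : exists a, M (classical_pt abs (Some w)) = classical_pt abs a.
      have [wb|wb] := eqVneq w b.
        by exists None; rewrite wb -(inv_at_inv_inf b); exact: M'K.
      exists (Some (w - b)^-1).
      have wE : M' (classical_pt abs (Some (w - b)^-1)) = classical_pt abs (Some w).
        by rewrite /M' inv_at_inv_classical ?invr_neq0 ?subr_eq0// invrK addrC subrK.
      by rewrite -wE; exact: M'K.
    by apply: hypQ'; exists a => //; rewrite -Ea Ew M'K.
  apply: hypQ'; exists (Some 0) => //.
  by rewrite -(M'K (classical_pt abs (Some 0))) /M' inv_at_inv_classical0 Ew M'K.
Qed.

(** If infinity is not fixed, [f - z g] has degree [deg phi + 1]. *)
Lemma fixed_root_exists : (ratFun_map phi (classical_pt abs None) <> classical_pt abs None) ->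
  exists b, root (f - 'X * g) b.
Proof.
move=> ninf; apply/closed_rootP; apply/eqP => s1.
have ge : g`_e != 0.
  apply/eqP => ge; apply: ninf; apply: classical_infP.
  by rewrite ratFun_map_Y hnorm_inf ?classical_inf1 ?size_den// ge absv0 mul0r.
have : (f - 'X * g)`_e.+1 = - g`_e.
  by rewrite coefB coefXM/= nth_default ?size_num// sub0r.
rewrite nth_default ?s1// => /eqP; rewrite eq_sym oppr_eq0.
by apply/negP.
Qed.

End Transfer.

Theorem theorem4p6 (R : realType) (K : closedFieldType) (abs : nonarchAbs R K)
    (hcomplete : abs_complete abs)
    (phi : ratFun K) (hdeg : (2 <= ratFun_deg phi)%N)
    (P : berkP1 abs) (v : set (R -> berkP1 abs)) (hv : tangent_dirs P v)
    (hsurj : ratFun_map phi @` dir_component P v = [set: berkP1 abs]) :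
  (exists a : option K, dir_component P v (classical_pt abs a) /\
     ratFun_map phi (classical_pt abs a) = classical_pt abs a) \/
  (exists Q : berkP1 abs, dir_component P v Q /\ repelling_fixed phi Q).
Proof.
have [fix_cl|nofix] := pselect (exists a : option K, dir_component P v (classical_pt abs a) /\
     ratFun_map phi (classical_pt abs a) = classical_pt abs a); [by left|right].
have [x0 _ UE] := dir_componentE hv; rewrite UE in hsurj nofix *.
have surj y : exists2 x, path_component R (~` [set P]) x0 x & ratFun_map phi x = y.
  by have : [set: berkP1 abs] y by []; rewrite -hsurj => -[x Ux <-]; exists x.
have nofix' a : path_component R (~` [set P]) x0 (classical_pt abs a) ->
    ratFun_map phi (classical_pt abs a) <> classical_pt abs a.
  by move=> Ua fa; apply: nofix; exists a.
have [Uinf|Uinf] := pselect (path_component R (~` [set P]) x0 (classical_pt abs None)).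
  have [b rb] := fixed_root_exists (nofix' _ Uinf).
  apply: (component_fixed_conj hdeg rb) => // Ub.
  exact: nofix' Ub (ratFun_map_classical_fixed abs rb).
have [] := component_fixed_disc Uinf surj.
  by move=> w Uw /(ratFun_map_classical_fixed abs); exact: nofix'.
move=> Q [UQ hQ fQ nQ]; exists Q; split=> //; split=> //.
apply: local_degree_ge2 => // V /nQ [c [y1 [y2 [q [_ V1 V2 E]]]]].
by exists c, y1, y2, q.
Qed.
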